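(* Let $\kappa$ be any cardinal and let $X=\prod_{\alpha<\kappa}X_\alpha$ (with the product topology), where each $X_\alpha$ is a completely regular Hausdorff space satisfying at least one of the following conditions: (i) $X_\alpha$ is an infinite compact $\mathscr R_2$-space; (ii) $X_\alpha$ contains a weak $P$-point; (iii) $X_\alpha$ has a nonempty sequentially small open subset. Suppose also that at least one $X_\alpha$ is an infinite compact $\mathscr R_2$-space. Then $X$ is not homogeneous.
   Context: All spaces are completely regular Hausdorff topological spaces. Sets $A,B\subset X$ are separated if $\overline A\cap B=A\cap\overline B=\varnothing$. A set is called discrete if it is discrete in the subspace topology (not necessarily closed). A space $X$ is an $\mathscr R_2$-space if any two separated countable subsets of $X$, one of which is discrete, have disjoint closures in $X$. A point $x\in X$ is a weak $P$-point if $x\notin\overline D$ whenever $D$ is a countable subset of $X\setminus\{x\}$. A space $X$ is sequentially small if any infinite set in $X$ has an infinite subset whose closure does not contain a copy (homeomorphic image) of $\beta\omega$, the Stone–Čech compactification of the countable discrete space $\omega$. A space $X$ is homogeneous if for any $x,y\in X$ there is a homeomorphism of $X$ onto itself taking $x$ to $y$. *)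

(* Defs.v *)
From HB Require Import structures.
From mathcomp Require Import all_boot all_order all_algebra.
From mathcomp Require Import all_classical all_reals all_analysis.

Set Implicit Arguments.
Unset Strict Implicit.
Unset Printing Implicit Defensive.

Local Open Scope classical_set_scope.

(** A set [A] used as a type denotes the subspace [set_type A]. *)

Definition homeomorphism (X Y : topologicalType) (h : X -> Y) : Prop :=
  continuous h /\
  exists g : Y -> X, [/\ continuous g, cancel h g & cancel g h].

Definition homogeneous (X : topologicalType) : Prop :=
  forall x y : X, exists h : X -> X, homeomorphism h /\ h x = y.

Definition discrete_set (X : topologicalType) (A : set X) : Prop :=
  forall U : set A, open U.

(** [countable] includes the finite sets. *)
Definition R2_space (X : topologicalType) : Prop :=
  forall A B : set X, countable A -> countable B -> separated A B ->
    discrete_set A \/ discrete_set B -> closure A `&` closure B = set0.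

Definition weak_P_point (X : topologicalType) (x : X) : Prop :=
  forall D : set X, countable D -> D `<=` ~` [set x] -> ~ closure D x.

(** The Stone-Cech compactification of the discrete space [nat]: the space of
    all (possibly principal) ultrafilters on [nat], with the sets
    [{p | A \in p}], for [A] a subset of [nat], as a base of open sets. The
    universal property is [beta_omega_stone_cech] below. *)
Record beta_omega : Type := BetaOmega {
  beta_filter : set_system nat ;
  beta_ultra : UltraFilter beta_filter }.
#[global] Existing Instance beta_ultra.

HB.instance Definition _ := gen_eqMixin beta_omega.
HB.instance Definition _ := gen_choiceMixin beta_omega.

Definition beta_basic (A : set nat) : set beta_omega :=
  [set p | beta_filter p A].

Lemma beta_basic_cover : \bigcup_(A in [set: set nat]) beta_basic A = setT.
Proof.
by rewrite -subTset => p _; exists setT => //; exact: (filterT (F := beta_filter p)).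
Qed.

Lemma beta_basic_join (A B : set nat) (p : beta_omega) :
  [set: set nat] A -> [set: set nat] B -> beta_basic A p -> beta_basic B p ->
  exists C, [/\ [set: set nat] C, beta_basic C p &
                beta_basic C `<=` beta_basic A `&` beta_basic B].
Proof.
move=> _ _ pA pB; exists (A `&` B); split => //.
  exact: (filterI (F := beta_filter p)).
by move=> q qAB; split; apply: (filterS (F := beta_filter q)) qAB => n [].
Qed.

HB.instance Definition _ :=
  isBaseTopological.Build beta_omega beta_basic_cover beta_basic_join.

Definition beta_inj (n : nat) : beta_omega :=
  BetaOmega (principal_filter_ultra n).

Definition contains_beta_omega (X : topologicalType) (A : set X) : Prop :=
  exists (B : set X) (h : beta_omega -> B), B `<=` A /\ homeomorphism h.

Definition sequentially_small (X : topologicalType) : Prop :=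
  forall A : set X, infinite_set A ->
    exists B : set X, [/\ B `<=` A, infinite_set B &
                          ~ contains_beta_omega (closure B)].

Definition infinite_compact_R2 (X : topologicalType) : Prop :=
  [/\ infinite_set [set: X], compact [set: X] & R2_space X].

(** The rest of the file checks that [beta_omega] with [beta_inj] is the
    Stone-Cech compactification of [nat]. *)

Lemma beta_basic_open (A : set nat) : open (beta_basic A).
Proof.
by exists [set A] => //; rewrite bigcup_set1.
Qed.

Lemma beta_nbhsP (p : beta_omega) (V : set beta_omega) :
  nbhs p V <-> exists2 A, beta_filter p A & beta_basic A `<=` V.
Proof.
split=> [|[A pA AV]].
  rewrite nbhsE => -[U [[D _ <-] [A DA pA]] UV].
  by exists A => // q qA; apply: UV; exists A.
rewrite nbhsE; exists (beta_basic A) => //.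
by split => //; exact: beta_basic_open.
Qed.

Lemma beta_omega_hausdorff : hausdorff_space beta_omega.
Proof.
move=> p q pq.
have sub A : beta_filter p A -> beta_filter q A.
  move=> pA; have [//|qA] := in_ultra_setVsetC A (beta_ultra q).
  have [r [rA rnA]] : beta_basic A `&` beta_basic (~` A) !=set0.
    by apply: pq; apply/beta_nbhsP; [exists A | exists (~` A)].
  have rAnA : beta_filter r (A `&` ~` A) .
    exact: (filterI (F := beta_filter r)).
  by have [n []] := [elaborate filter_ex rAnA].
have pqE : beta_filter q = beta_filter p by exact: max_filter.
case: p q pqE {pq sub} => [F FU] [G GU] /= GF; case: _ / GF in FU GU *.
by rewrite (Prop_irrelevance FU GU).
Qed.

Lemma beta_omega_compact : compact [set: beta_omega].
Proof.
rewrite compact_ultra /= => F FU _.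
pose p : set_system nat := [set A | F (beta_basic A)].
have pF : ProperFilter p.
  apply: Build_ProperFilter_ex.
    move=> A pA; have [q qA] := [elaborate @filter_ex _ F _ (beta_basic A) pA].
    exact: (filter_ex (F := beta_filter q)).
  split.
  - by apply: (filterE (F := F)) => q; exact: (filterT (F := beta_filter q)).
  - move=> A B pA pB.
    have pAB : F (beta_basic A `&` beta_basic B) by exact: filterI.
    apply: (filterS (F := F)) pAB => q [].
    exact: (filterI (F := beta_filter q)).
  - move=> A B AB; apply: (filterS (F := F)) => q; exact: (filterS (F := beta_filter q)).
have pU : UltraFilter p.
  split=> // G GP pG; apply/seteqP; split; last by [].
  move=> A GA; have [//|nA] := in_ultra_setVsetC (beta_basic A) FU.
  have /pG GnA : p (~` A).
    apply: filterS nA => q /= nqA.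
    by have [] := in_ultra_setVsetC A (beta_ultra q).
  by have [n []] := [elaborate filter_ex (filterI GA GnA)].
exists (BetaOmega pU); split => // V /beta_nbhsP [A /= pA AV].
exact: filterS AV _.
Qed.

Lemma beta_inj_cvg (p : beta_omega) : beta_inj @ beta_filter p --> p.
Proof.
move=> V /beta_nbhsP [A pA AV]; apply: (filterS (F := beta_filter p)) pA => n An.
by apply: AV; exact/principal_filterP.
Qed.

Lemma beta_omega_stone_cech :
  [/\ compact [set: beta_omega], hausdorff_space beta_omega, continuous beta_inj &
    forall (K : topologicalType) (f : nat -> K),
      compact [set: K] -> hausdorff_space K -> continuous f ->
      exists! g : beta_omega -> K, continuous g /\ g \o beta_inj = f].
Proof.
split; [exact: beta_omega_compact|exact: beta_omega_hausdorff| |].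
  move=> n V nV; have nn : nbhs (n : nat) [set n] by exact: discrete_set1.
  by apply: (filterS _ nn) => _ ->; exact: nbhs_singleton nV.
move=> K f Kc Kh _.
have lim_ex (p : beta_omega) : exists y : K, f @ beta_filter p --> y.
  have fpU : UltraFilter (f @ beta_filter p).
    split; first exact: fmap_proper_filter.
    move=> G GP fpG; apply/seteqP; split; last exact: fpG.
    move=> A GA.
    have [//|nA] := in_ultra_setVsetC (f @^-1` A) (beta_ultra p).
    have /fpG GnA : (f @ beta_filter p) (~` A) by [].
    by have [n []] := [elaborate filter_ex (filterI GA GnA)].
  move: Kc; rewrite compact_ultra => /(_ _ fpU filterT) [y [_ py]].
  by exists y.
pose g p := sval (cid (lim_ex p)).
have gE p : f @ beta_filter p --> g p by exact: svalP (cid (lim_ex p)).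
exists g; split.
  split; last first.
    apply/funext => n /=; apply: esym; apply: contrapT => fgn.
    have nb : nbhs (g (beta_inj n)) (~` [set f n]).
      apply: open_nbhs_nbhs; split; last by move=> /esym.
      rewrite openC; apply: accessible_closed_set1.
      exact: hausdorff_accessible.
    by have /principal_filterP /= := gE (beta_inj n) _ nb; apply.
  move=> p V gV.
  have [W nW WV] := @compact_regular K (g p) setT Kh Kc filterT V gV.
  apply/beta_nbhsP; exists (f @^-1` W); first exact: gE.
  move=> q qW; apply: WV => U /gE qU.
  by have [n [? ?]] := [elaborate filter_ex (filterI qW qU)]; exists (f n).
move=> h [hc hf]; apply/funext => p.
apply: (cvg_unique Kh (F := f @ beta_filter p)); first exact: gE.
have hp : (h \o beta_inj) @ beta_filter p --> h p.
  by move=> V /(hc p); exact: beta_inj_cvg.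
by rewrite hf in hp.
Qed.

(* Main.v *)
(** Fix a free ultrafilter [q] and a weak P-point [p] of ω* that is not a
    Rudin-Keisler image of [q].  In a compact R2-space the [p]-limit [x] of a
    discrete sequence is not the [q]-limit of any sequence of points other than
    [x], and neither is a weak P-point.  Let [x] in the product have such
    coordinates at the factors (i) and (ii), and a coordinate in the
    sequentially small open set at the factors (iii).  Change one coordinate of
    [x], in an infinite compact R2-factor, into the limits [e_u] of a discrete
    sequence along the ultrafilters [u], and suppose that a homeomorphism [h]
    sends [e_q] to [x].  If [c] is a discrete sequence in an R2-space and
    [d_i <> c_i] for all [i], then [c] and [d] have disjoint closures along some
    infinite set of indices; hence some finite set of coordinates, the same for
    all free [u], is such that the restriction of [h (e_u)] to it determines [u].
    Near [q] the coordinates of type (i) and (ii) among these are constant, so βω embeds in a finite product of factors (iii), hence in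
    one of them, inside its sequentially small open set; but a sequentially
    small space contains no copy of βω.

    The existence of [p] is due to Kunen: along a recursion of length 2^ω, an
    independent linked family (built as by Simon) provides the sets that make
    [p] avoid the closures of countable sets. *)
Require Import Defs.
From mathcomp Require Import all_boot all_order all_algebra.
From mathcomp Require Import all_classical all_reals all_analysis wochoice.

Set Implicit Arguments.
Unset Strict Implicit.
Unset Printing Implicit Defensive.

Local Open Scope classical_set_scope.


(** * An ultrafilter that is a weak P-point *)

Lemma finite_nat_bound (A : set nat) :
  finite_set A -> exists K, forall i, A i -> (i <= K)%N.
Proof.
move=> /finite_seqP[s ->]; exists (\max_(i <- s) i) => i /= si.
exact: leq_bigmax_seq.
Qed.

Definition cut (k : nat) (X : set nat) : k.-tuple bool :=
  [tuple `[< X i >] | i < k].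

Lemma cut_neq (X Y : set nat) :
  X <> Y -> exists K, forall k, (K <= k)%N -> cut k X <> cut k Y.
Proof.
move=> XY; apply: contrapT => nK; apply: XY; apply/predeqP => i.
apply: contrapT => Xi; apply: nK; exists i.+1 => k ik.
move=> /(congr1 (fun t => tnth t (Ordinal ik))).
by rewrite !tnth_mktuple /= => e; apply: Xi; split=> /asboolP; [rewrite e|rewrite -e] => /asboolP.
Qed.

Definition simon_index : Type := {k : nat & {set k.-tuple bool * k.-tuple bool}}.

(* Simon's family: the row [X] at level [n] consists of the (codes of) binary
   relations on {0,1}^k that relate [X] restricted to k to at most [n] elements;
   the column [Y] asks that the restriction of [Y] be among them. *)
Definition simon_set (X : set nat) (n : nat) (Y : set nat) : set nat :=
  [set m | exists s : simon_index, [/\ pickle s = m,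
     (cut (tag s) X, cut (tag s) Y) \in tagged s &
     (#|[pred y | (cut (tag s) X, y) \in tagged s]| <= n)%N]].

Lemma simon_set_mono X n n' Y :
  (n <= n')%N -> simon_set X n Y `<=` simon_set X n' Y.
Proof. by move=> nn' m [s [sm sXY sn]]; exists s; split => //; exact: leq_trans nn'. Qed.

Lemma finite_simon_small K :
  finite_set [set m | exists2 s : simon_index, pickle s = m & (tag s < K)%N].
Proof.
apply: (@sub_finite_set _ _ (\bigcup_(k in `I_K)
   ((fun t : {set k.-tuple bool * k.-tuple bool} =>
      pickle (Tagged (fun k => {set k.-tuple bool * k.-tuple bool}) t))
     @` setT))).
  by move=> _ [[k t] <- /= kK]; exists k => //; exists t.
apply: bigcup_finite; first exact: finite_II.
by move=> k _; apply: finite_image; exact: finite_finset.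
Qed.

(** Once the level separates the [n.+1] columns, a common code would relate the restriction of [X]
    to more than [n] elements. Only the finitely many codes of smaller level remain. *)
Lemma simon_set_linked X n (Y : nat -> set nat) : injective Y ->
  finite_set (\bigcap_(i in `I_n.+1) simon_set X n (Y i)).
Proof.
move=> Yinj.
have [K KP] : exists K, forall k i j, (K <= k)%N -> (i < n.+1)%N -> (j < n.+1)%N ->
    cut k (Y i) = cut k (Y j) -> i = j.
  have /choice[Kf KfP] (i : nat * nat) : exists K, forall k, (K <= k)%N ->
      cut k (Y i.1) = cut k (Y i.2) -> i.1 = i.2.
    have [e|ne] := pselect (i.1 = i.2); first by exists 0.
    have [|K KP] := @cut_neq (Y i.1) (Y i.2); first by move/Yinj.
    by exists K => k Kk /(KP _ Kk).
  exists (\max_(i < n.+1) \max_(j < n.+1) Kf (i : nat, j : nat)) => k i j Kk im jm.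
  apply: (KfP (i, j)); apply: leq_trans Kk.
  apply: (leq_trans _ (leq_bigmax (Ordinal im))).
  exact: (leq_trans _ (leq_bigmax (Ordinal jm))).
apply: (@sub_finite_set _ _ _ _ (finite_simon_small K)) => m mY.
have [s0 [sm _ sn]] := mY 0 isT.
exists s0 => //; rewrite ltnNge; apply/negP => Ks.
move: sn; apply/negP; rewrite -ltnNge.
pose g (i : 'I_n.+1) := cut (tag s0) (Y i).
have ginj : injective g by move=> i j /KP ij; apply/val_inj/ij.
rewrite -[n.+1]card_ord -(card_codom ginj); apply: subset_leq_card.
apply/fintype.subsetP => _ /codomP[i ->]; rewrite inE {ginj}/g.
have [s [sm' sY _]] := mY i (ltn_ord i).
suff e : s = s0 by subst s0.
by apply: (pcan_inj pickleK); rewrite sm sm'.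
Qed.

Section Cells.
Variables (R : Type) (code : R -> set nat).
Hypothesis code_inj : injective code.

Definition row_cell (r : R) n (Y : nat -> set nat) : set nat :=
  \bigcap_(i in `I_n) simon_set (code r) n (Y i).

(* [cell D E]: [E] is an intersection of sets of the family, taken in the rows of
   the finite set [D], with at most [n] columns from a row at level [n]. *)
Inductive cell : set R -> set nat -> Prop :=
| cell_nil : cell set0 setT
| cell_cons D E r n Y : cell D E -> ~ D r ->
    cell (r |` D) (row_cell r n Y `&` E).

Lemma cell_finite D E : cell D E -> finite_set D.
Proof. by elim=> // {}D {}E r n Y _ fD _; rewrite finite_setU. Qed.

Lemma cell_setI D E D' E' : cell D E -> cell D' E' -> D `&` D' = set0 ->
  cell (D `|` D') (E `&` E').
Proof.
move=> cDE cDE'; elim: cDE => [|{}D {}E r n Y cDE IH Dr DD'].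
  by rewrite set0U setTI.
rewrite -setUA -setIA; apply: cell_cons.
  apply: IH; apply/seteqP; split => // z [Dz D'z].
  by rewrite -DD'; split => //; right.
move=> [//|D'r]; suff : (@set0 R) r by [].
by rewrite -DD'; split => //; left.
Qed.

Lemma cell_infinite D E : cell D E -> infinite_set E.
Proof.
move=> cDE.
(* At every large level some relation [t] lives over the restrictions of the rows in [D], and [E]
   contains the code of every [t'] with the same sections over them. The section over a new row thus
   stays free in the induction. *)
suff [K KP] : exists K, forall k, (K <= k)%N ->
    exists2 t : {set k.-tuple bool * k.-tuple bool},
      (forall x, x \in t -> exists2 r, D r & x.1 = cut k (code r)) &
      forall t' : {set k.-tuple bool * k.-tuple bool},
        (forall r y, D r -> ((cut k (code r), y) \in t') =
                            ((cut k (code r), y) \in t)) ->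
      E (pickle (Tagged (fun k => {set k.-tuple bool * k.-tuple bool}) t')).
  pose g (m : nat) := odflt 0 (omap tag (unpickle m : option simon_index)).
  move=> /(finite_image g) /sub_finite_set fE.
  have : finite_set (~` `I_K).
    apply: fE => k /negP; rewrite -leqNgt => Kk.
    have [t _ /(_ t)] := KP _ Kk; move=> /(_ (fun _ _ _ => erefl)) Et.
    by eexists; first exact: Et; rewrite /g pickleK.
  have := infinite_nat; rewrite -(setUv `I_K) finite_setU => + fK; apply.
  by split => //; exact: finite_II.
elim: cDE => [|{}D {}E r n Y cDE [K KP] Dr].
  by exists 0 => k _; exists finset.set0 => // x; rewrite inE.
have [K' KP'] : exists K', forall k r', (K' <= k)%N -> D r' ->
    cut k (code r) <> cut k (code r').
  have /choice[Kf KfP] (r' : R) : exists K, forall k, (K <= k)%N -> D r' ->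
      cut k (code r) <> cut k (code r').
    have [Dr'|nD] := pselect (D r'); last by exists 0 => k _ /nD.
    have [|K' K'P] := @cut_neq (code r) (code r').
      by move/code_inj => rr'; apply: Dr; rewrite rr'.
    by exists K' => k Kk _; exact: K'P.
  have [K' K'P] := finite_nat_bound (finite_image Kf (cell_finite cDE)).
  exists K' => k r' K'k Dr'; apply: KfP => //.
  by apply: leq_trans K'k; apply: K'P; exists r'.
exists (maxn K K') => k; rewrite geq_max => /andP[Kk K'k].
have [t tD tE] := KP _ Kk.
(* Since [k] is at least [K'], the new row restricts differently from the rows of [D], and the added
   pairs leave their sections unchanged. *)
exists (t :|: finset.imset (fun i : 'I_n => (cut k (code r), cut k (Y i))) (mem predT)).
  move=> x /finset.setUP[/tD[r' Dr' ->]|/finset.imsetP[i _ ->]]; first by exists r' => //; right.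
  by exists r => //; left.
move=> t' t'P; split.
  move=> i /= ilt; eexists; split; first reflexivity.
    rewrite /= t'P; last by left.
    by apply/finset.setUP; right; apply/finset.imsetP; exists (Ordinal ilt).
  rewrite /=.
  apply: (@leq_trans #|finset.imset (fun i : 'I_n => cut k (Y i)) (mem predT)|); last first.
    by rewrite (leq_trans (leq_imset_card _ _))// card_ord.
  apply: subset_leq_card; apply/fintype.subsetP => y; rewrite inE t'P; last by left.
  move=> /finset.setUP[/tD[r' Dr' /= rr']|/finset.imsetP[j _ [->]]]; last exact: finset.imset_f.
  by have := KP' _ _ K'k Dr'.
apply: tE => r' y Dr'; rewrite t'P; last by right.
apply/finset.setUP/idP => [[//|/finset.imsetP[j _ /(congr1 fst) /= e]]|]; last by left.
by have := KP' _ _ K'k Dr'; rewrite -e.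
Qed.
End Cells.


Lemma disjoint_subr (T : Type) (A B C : set T) :
  B `<=` C -> A `&` C = set0 -> A `&` B = set0.
Proof. by move=> BC A0; apply/seteqP; split => [x [xA /BC xC]|//]; rewrite -A0; split. Qed.

Lemma countable_setU (T : Type) (A B : set T) :
  countable A -> countable B -> countable (A `|` B).
Proof.
by move=> cA cB; rewrite -bigcup2E; apply: bigcup_countable => // -[|[|k]] _.
Qed.

Section Admissible.
Variables (R : Type) (code : R -> set nat).
Hypothesis code_inj : injective code.
Local Notation cell := (cell code).

(* [D] is the set of the rows already used. *)
Definition admissible (D : set R) (F : set_system nat) :=
  [/\ Filter F, forall B, finite_set (~` B) -> F B &
      forall B D0 E, F B -> cell D0 E -> D0 `&` D = set0 -> B `&` E !=set0].

Lemma admissible_cofinite : admissible set0 [set B | finite_set (~` B)].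
Proof.
split=> [|//|B D0 E fB cE _]; last first.
  have /infinite_setN0[x [Ex nBx]] := infinite_setD (cell_infinite code_inj cE) fB.
  by exists x; split => //; exact: contrapT.
split=> [|P Q fP fQ|P Q PQ]; first by rewrite /= setCT; exact: finite_set0.
  apply: (@sub_finite_set _ _ (~` P `|` ~` Q)); last by rewrite finite_setU.
  by move=> x /not_andP.
by apply: sub_finite_set; exact: subsetC.
Qed.

(** [F'] is generated by [F] and the sets [V i]; [n] and [u] run through the finite intersections,
    and [i0] fills [u] when the intersection is empty. *)
Lemma admissible_extend (D D' : set R) (F : set_system nat) (I : Type) (i0 : I)
    (V : I -> set nat) :
  admissible D F ->
  (forall B n (u : nat -> I) D0 E, F B -> cell D0 E -> D0 `&` D' = set0 ->
     B `&` \bigcap_(k in `I_n) V (u k) `&` E !=set0) ->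
  exists F', [/\ F `<=` F', forall i, F' (V i) & admissible D' F'].
Proof.
move=> [FF Fcof _] FV.
pose F' : set_system nat := [set C | exists B n (u : nat -> I),
  F B /\ B `&` \bigcap_(k in `I_n) V (u k) `<=` C].
have FF' : F `<=` F'.
  by move=> B FB; exists B, 0, (fun=> i0); split => // x [].
exists F'; split => //.
  move=> i; exists setT, 1, (fun=> i); split; first exact: filterT.
  by move=> x [_ /(_ 0)]; exact.
split; last 2 first.
- by move=> B /Fcof /FF'.
- move=> C D0 E [B [n [u [FB BC]]]] cE DE.
  by have [x [/BC Cx Ex]] := FV _ n u _ _ FB cE DE; exists x.
split=> [|P Q [B [n [u [FB BP]]]] [B' [n' [u' [FB' BQ]]]]|P Q PQ [B [n [u [FB BP]]]]].
- by apply: FF'; exact: filterT.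
- exists (B `&` B'), (n + n')%N, (fun k => if (k < n)%N then u k else u' (k - n)%N).
  split; first exact: filterI.
  move=> x [[Bx B'x] Vx]; split; [apply: BP|apply: BQ]; split => // k /= kn.
    by have := Vx k; rewrite /= kn; apply; exact: ltn_addr.
  have := Vx (n + k)%N; rewrite /= ltn_add2l => /(_ kn).
  by rewrite ltnNge leq_addr /= addKn.
- by exists B, n, u; split => //; exact: subset_trans PQ.
Qed.

Lemma admissible_decide (D : set R) (F : set_system nat) (A : set nat) :
  admissible D F -> exists F' D', [/\ F `<=` F', countable D',
    admissible (D `|` D') F' & F' A \/ F' (~` A)].
Proof.
move=> aF; have [FF Fcof Find] := aF.
have [[B [D0 [E [FB cE D0D BAE]]]]|nA] := pselect (exists B D0 E,
    [/\ F B, cell D0 E, D0 `&` D = set0 & B `&` A `&` E = set0]).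
  have [|F' [FF' /(_ tt) F'E aF']] :=
      @admissible_extend D (D `|` D0) F unit tt (fun=> E) aF.
    move=> C n u D1 E1 FC cE1 D1D.
    have D1D0 : D1 `&` D0 = set0.
      by exact: disjoint_subr (@classical_sets.subsetUr _ _ _) D1D.
    have [|x [Cx [E1x Ex]]] := Find C _ _ FC (cell_setI cE1 cE D1D0).
      by rewrite setIUl D0D setU0; exact: disjoint_subr (@classical_sets.subsetUl _ _ _) D1D.
    by exists x; split => //; split.
  exists F', D0; split => //; first exact/finite_set_countable/cell_finite/cE.
  right; case: aF' => ? _ _; apply: filterS (filterI (FF' _ FB) F'E).
  by move=> x [Bx Ex] Ax; suff: (@set0 nat) x by []; rewrite -BAE; split.
have [|F' [FF' /(_ tt) F'A aF']] := @admissible_extend D D F unit tt (fun=> A) aF.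
  move=> B n u D0 E FB cE D0D; apply: contrapT => BAE; apply: nA.
  exists B, D0, E; split => //; apply/seteqP; split => // x [[Bx Ax] Ex].
  by apply: BAE; exists x; split => //; split.
by exists F', set0; split; rewrite ?setU0//; left.
Qed.

Lemma admissible_union (J : Type) (j0 : J) (F : J -> set_system nat)
    (D : J -> set R) (D' : set R) :
  (forall i j, exists k, F i `<=` F k /\ F j `<=` F k) ->
  (forall j, admissible (D j) (F j)) -> (forall j, D j `<=` D') ->
  admissible D' (\bigcup_j F j).
Proof.
move=> dF aF DD'; split; last 2 first.
- by move=> B fB; exists j0 => //; have [_ + _] := aF j0; apply.
- move=> B D0 E [j _ FB] cE D0D'; have [_ _] := aF j; apply; eauto.
  exact: disjoint_subr D0D'.
split=> [|P Q [i _ FP] [j _ FQ]|P Q PQ [i _ FP]].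
- by exists j0 => //; have [? _ _] := aF j0; exact: filterT.
- have [k [ik jk]] := dF i j; have [? _ _] := aF k.
  by exists k => //; apply: filterI; [exact: ik|exact: jk].
- by have [? _ _] := aF i; exists i => //; exact: filterS FP.
Qed.

Lemma admissible_decide_seq (D : set R) (F : set_system nat) (U : nat -> set nat) :
  admissible D F -> exists F' D', [/\ F `<=` F', countable D',
    admissible (D `|` D') F' & forall n, F' (U n) \/ F' (~` (U n))].
Proof.
move=> aF.
pose step n (s s' : set_system nat * set R) :=
  admissible s.2 s.1 -> exists D', [/\ s.1 `<=` s'.1, countable D',
    s'.2 = s.2 `|` D', admissible s'.2 s'.1 & s'.1 (U n) \/ s'.1 (~` (U n))].
have /choice[f fP] (ns : nat * (set_system nat * set R)) :
    exists s', step ns.1 ns.2 s'.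
  case: ns => n s /=; have [as_|nas] := pselect (admissible s.2 s.1); last first.
    by exists s => /nas.
  have [F' [D' [sF' cD' aD' UF']]] := admissible_decide (U n) as_.
  by exists (F', s.2 `|` D') => _; exists D'.
pose g := fix g n := if n is m.+1 then f (m, g m) else (F, D).
have ag n : admissible (g n).2 (g n).1.
  by elim: n => [//|n IHn]; have [D' []] := fP (n, g n) IHn.
have gmono m n : (m <= n)%N -> (g m).1 `<=` (g n).1.
  move=> /subnKC <-; elim: (n - m)%N => [|k IHk]; first by rewrite addn0.
  rewrite addnS; apply: subset_trans IHk _.
  by have [D' []] := fP ((m + k)%N, g (m + k)%N) (ag _).
have /choice[C CP] n : exists C, countable C /\ (g n).2 = D `|` C.
  elim: n => [|n [C [cC gC]]]; first by exists set0; rewrite setU0; split.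
  have [D' [_ cD' + _ _]] := fP (n, g n) (ag n); rewrite /= gC => ->.
  by exists (C `|` D'); rewrite setUA; split => //; exact: countable_setU.
exists (\bigcup_n (g n).1), (\bigcup_n C n); split.
- by move=> B FB; exists 0.
- by apply: bigcup_countable => // n _; have [] := CP n.
- apply: (@admissible_union _ 0 (fun n => (g n).1) (fun n => (g n).2)) => //.
    by move=> i j; exists (maxn i j); split; apply: gmono; rewrite leq_max leqnn ?orbT.
  move=> n; have [_ ->] := CP n.
  by move=> r [Dr|Cr]; [left|right; exists n].
- move=> n; have [D' [_ _ _ _ /= []]] := fP (n, g n) (ag n) => Un; [left|right];
  by exists n.+1.
Qed.

(* Any [n.+1] of the sets [V Y] meet below [U n.+1], up to a finite set: Kunen's
   OK property for the decreasing sequence [U]. *)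
Definition linked_below (F : set_system nat) (U : nat -> set nat) :=
  U 0 = setT -> (forall n, U n.+1 `<=` U n) -> (forall n, F (U n)) ->
  exists2 V : set nat -> set nat, forall Y, F (V Y) &
    forall (Y : nat -> set nat), injective Y -> forall n,
      finite_set ((\bigcap_(i in `I_n.+1) V (Y i)) `\` U n.+1).

Lemma admissible_linked (D : set R) (F : set_system nat) (U : nat -> set nat) r :
  admissible D F -> ~ D r ->
  exists F', [/\ F `<=` F', admissible (D `|` [set r]) F' & (forall n, F (U n)) -> linked_below F' U].
Proof.
move=> aF Dr; have [FF Fcof Find] := aF.
have [[U0 Udec FU]|nU] := pselect [/\ U 0 = setT, forall n, U n.+1 `<=` U n & forall n, F (U n)]; last first.
  (* Nothing is to be achieved for such a [U]; adding [setT] only marks the row [r] as used. *)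
  have [|F' [FF' _ aF']] := @admissible_extend D (D `|` [set r]) F unit tt (fun=> setT) aF.
    move=> B n _ D0 E FB cE D0D.
    have [|x [Bx Ex]] := Find B _ _ FB cE.
      by exact: disjoint_subr (@classical_sets.subsetUl _ _ _) D0D.
    by exists x; split => //; split.
  by exists F'; split => // FU ? ? _; exfalso; apply: nU; split.
have Umono m n : (m <= n)%N -> U n `<=` U m.
  move=> /subnKC <-; elim: (n - m)%N => [|k IHk]; first by rewrite addn0.
  by rewrite addnS; apply: subset_trans IHk; exact: Udec.
(* On the layer [U n] minus [U n.+1] the column is taken at level [n]. Inside [U n] the levels are
   at least [n], so that [n] sets [V (u k)] contain a cell of level [n]; outside [U n.+1] only the
   layers up to [n] occur, and on layer [k] already [k.+1] columns meet in a finite set. *)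
pose V (Y : set nat) : set nat :=
  [set m | forall n, U n m -> ~ U n.+1 m -> simon_set (code r) n Y m].
have [|F' [FF' F'V aF']] := @admissible_extend D (D `|` [set r]) F (set nat) set0 V aF.
  move=> B n u D0 E FB cE D0D.
  have cE' : cell (r |` D0) (row_cell code r n u `&` E).
    apply: cell_cons => // D0r; suff: (@set0 R) r by [].
    by rewrite -D0D; split => //; right.
  have [|x [[Bx Unx] [rx Ex]]] := Find (B `&` U n) _ _ (filterI FB (FU n)) cE'.
    apply/seteqP; split => // z [[->//|D0z] Dz].
    by rewrite -D0D; split => //; left.
  exists x; split => //; split => // k kn m Umx nUmx.
  apply: (@simon_set_mono _ n); last exact: rx.
  by rewrite leqNgt; apply/negP => mn; apply: nUmx; exact: Umono Unx.
exists F'; split => // _ _ _ _; exists V => // Y Yinj n.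
apply: (@sub_finite_set _ _ (\bigcup_(k in `I_n.+1)
   \bigcap_(i in `I_k.+1) simon_set (code r) k (Y i))); last first.
  by apply: bigcup_finite => [|k _]; [exact: finite_II|exact: simon_set_linked].
move=> m [Vm nUm].
have [k kn [Ukm nUkm]] : exists2 k, (k < n.+1)%N & U k m /\ ~ U k.+1 m.
  elim: n nUm {Vm} => [|n IHn] nUm; first by exists 0 => //; rewrite U0.
  have [Unm|/IHn[k kn ?]] := pselect (U n.+1 m); first by exists n.+1.
  by exists k => //; exact: ltnW.
exists k => // i ik; apply: Vm => //=; exact: leq_trans ik _.
Qed.

(** Two columns [V 0] and [V 1] of level 1 meet in a finite set, and each can be added to [F]. If
    [q] contains both preimages under [f], it contains that of their intersection, whose cofinite
    complement then serves. *)
Lemma admissible_not_image (D : set R) (F : set_system nat) q (f : nat -> nat) r :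
  ProperFilter q -> admissible D F -> ~ D r ->
  exists F', [/\ F `<=` F', admissible (D `|` [set r]) F' &
     exists2 V, F' V & ~ q (f @^-1` V)].
Proof.
move=> qF aF Dr; have [FF Fcof Find] := aF.
pose Y (i : nat) := [set i].
have Yinj : injective Y by move=> i j ij; have : Y i i by []; rewrite ij.
pose V i := row_cell code r 1 (fun=> Y i).
have extV i : exists F', [/\ F `<=` F', F' (V i) & admissible (D `|` [set r]) F'].
  have [|F' [FF' /(_ tt) F'V aF']] :=
    @admissible_extend D (D `|` [set r]) F unit tt (fun=> V i) aF; last by exists F'.
  move=> B n u D0 E FB cE D0D.
  have cE' : cell (r |` D0) (V i `&` E).
    apply: cell_cons => // D0r; suff: (@set0 R) r by [].
    by rewrite -D0D; split => //; right.
  have [|x [Bx [rx Ex]]] := Find B _ _ FB cE'.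
    apply/seteqP; split => // z [[->//|D0z] Dz].
    by rewrite -D0D; split => //; left.
  by exists x; split => //; split.
have [F0 [FF0 F0V aF0]] := extV 0; have [F1 [FF1 F1V aF1]] := extV 1.
have [q0|nq0] := pselect (q (f @^-1` V 0)); last first.
  by exists F0; split => //; exists (V 0).
have [q1|nq1] := pselect (q (f @^-1` V 1)); last first.
  by exists F1; split => //; exists (V 1).
exists F0; split => //; exists (~` (V 0 `&` V 1)).
  apply: FF0; apply: Fcof; rewrite setCK.
  apply: sub_finite_set (simon_set_linked (code r) 1 Yinj) => m [V0 V1] i /=.
  by case: i => [_|[_|//]]; [exact: (V0 0 isT)|exact: (V1 0 isT)].
move=> qn; have [m [[V0 V1] nV]] := filter_ex (filterI (filterI q0 q1) qn).
by apply: nV.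
Qed.

End Admissible.


Lemma countable_enum (T : Type) (x0 : T) (A : set T) : countable A ->
  exists g : nat -> T, A `<=` range g.
Proof.
move=> /pcard_injP[f finj].
have /choice[g gP] (n : nat) : exists x, (exists2 y, A y & f y = n) -> A x /\ f x = n.
  by have [[y Ay fy]|ny] := pselect (exists2 y, A y & f y = n);
    [exists y|exists x0 => /ny].
exists g => x Ax; exists (f x) => //.
have [|Ag fg] := gP (f x); first by exists x.
by apply: finj => //; apply/mem_set.
Qed.

Lemma uncountable_powerset : ~ countable [set: set nat].
Proof.
move=> /(countable_enum set0)[g gP].
have [n _ gn] := gP [set n | ~ g n n] I.
have nn : ~ g n n by move=> h; have := h; rewrite {1}gn; apply.
by apply: (nn); rewrite gn.
Qed.

Lemma infinite_seq (T : Type) (A : set T) :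
  infinite_set A -> exists2 f : nat -> T, injective f & forall n, A (f n).
Proof.
elim/Ppointed: T => T in A *; first by move=> /infinite_setN0[x]; case: (no x).
move=> /infiniteP /pcard_leP[f]; exists f => [i j|n]; first by apply: inj; rewrite inE.
exact: (@funS _ _ _ _ f).
Qed.

Lemma filter_bigI_nat (T : Type) (F : set_system T) n (V : nat -> set T) :
  Filter F -> (forall i, (i < n)%N -> F (V i)) -> F (\bigcap_(i in `I_n) V i).
Proof.
move=> FF; elim: n => [|n IHn] FV; first by apply: filterS filterT => x _ i.
apply: filterS (filterI (IHn (fun i il => FV i (ltnW il))) (FV n (ltnSn n))).
move=> x [xV xn] i /=; rewrite ltnS leq_eqVlt => /orP[/eqP -> //|]; exact: xV.
Qed.

Lemma ultra_finite (T : Type) (a : set_system T) (S : set T) :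
  UltraFilter a -> (forall k, ~ a [set k]) -> finite_set S -> ~ a S.
Proof.
move=> aU anp /(@finite_seqP {classic T})[s ->] {S}; elim: s => [|x s IHs].
  by move=> /filter_ex[].
move=> axs; have [//|nax] := in_ultra_setVsetC [set x] aU; first by move/anp.
apply: IHs; apply: filterS (filterI axs nax) => y [/=].
by rewrite inE => /orP[/eqP|].
Qed.

Section Stage.
Variables (R : Type) (code : R -> set nat) (q : set_system nat).
Hypotheses (code_inj : injective code) (qF : ProperFilter q).

(** One sequence encodes three tasks: sets to decide, a decreasing sequence for the OK property and,
    through [xget], a map of [nat], any [f] being encoded by the singletons of its values. *)
Definition task_done (U : nat -> set nat) (F : set_system nat) :=
  [/\ forall n, F (U n) \/ F (~` (U n)), (forall n, F (U n)) -> linked_below F U &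
      exists2 V, F V & ~ q ((fun n => xget 0 (U n)) @^-1` V)].

Lemma admissible_proper (D : set R) F : admissible code D F -> ProperFilter F.
Proof.
move=> [FF _ Find]; apply: Build_ProperFilter_ex => B FB.
by have [|x [Bx _]] := Find _ _ _ FB (@cell_nil _ code); [rewrite set0I|exists x].
Qed.

Lemma admissible_stage (D : set R) F (U : nat -> set nat) :
  (forall C, countable C -> exists2 r, ~ D r & ~ C r) -> admissible code D F ->
  exists F' D', [/\ F `<=` F', countable D', admissible code (D `|` D') F' &
    task_done U F'].
Proof.
move=> fresh aF.
have [F1 [D1 [FF1 cD1 aF1 dec]]] := admissible_decide_seq U aF.
have [r1 Dr1 D1r1] := fresh _ cD1.
have [|F2 [F12 aF2 lnk]] := admissible_linked U aF1 (r := r1); first by case.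
have c1 : countable (D1 `|` [set r1]) by exact: countable_setU.
have [r2 Dr2 D1r2] := fresh _ c1.
have [|F3 [F23 aF3 [V F3V qV]]] :=
  admissible_not_image (fun n => xget 0 (U n)) qF aF2 (r := r2).
  by rewrite -setUA => -[].
have F13 := subset_trans F12 F23.
exists F3, (D1 `|` [set r1] `|` [set r2]); split.
- exact: subset_trans FF1 F13.
- exact: countable_setU.
- by move: aF3; rewrite !setUA.
- split; [|move=> F3U|by exists V].
    by move=> n; have [] := dec n; [left|right]; exact: F13.
  (* [lnk] speaks of [F1], so the [U n] are traced back to [F1], where each of them was decided. *)
  have F1U n : F1 (U n).
    have [//|/F13 F3n] := dec n; have F3P := admissible_proper aF3.
    by have [x []] := filter_ex (filterI (F3U n) F3n).
  move=> U0 Ud _; have [W F2W WP] := lnk F1U U0 Ud (fun n => F12 _ (F1U n)).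
  by exists W => // Y; exact: F23.
Qed.

End Stage.

(** This is the initial ordinal of the cardinality of [T]: a well-order of [T], cut at the first
    point whose predecessors can be mapped onto [T], if there is one. *)
Lemma small_well_order (T : Type) : exists (J : Type) (lt : J -> J -> Prop) (task : J -> T),
  [/\ well_founded lt, (forall a b c, lt a b -> lt b c -> lt a c),
      (forall a b, [\/ lt a b, a = b | lt b a]), (forall t, exists j, task j = t) &
      forall j (g : J -> T), exists t, forall s, lt s j -> g s <> t].
Proof.
have [r rwo] := @well_ordering_principle {classic T}.
have rwc : wo_chain r predT by move=> A _; exact: rwo.
have rtot : total r by move=> x y; exact: (wo_chainW rwc).
have ranti : antisymmetric r by move=> x y; exact: (wo_chain_antisymmetric rwc).
pose lt (x y : T) : Prop := ~ r y x.
have minP (P : T -> Prop) : (exists x, P x) -> exists x, P x /\ forall y, lt y x -> ~ P y.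
  move=> [x Px]; have [|z [[zP zmin] _]] := rwo [pred x | `[< P x >]].
    by exists x; apply/asboolP.
  exists z; split; first exact/asboolP/zP.
  by move=> y nzy Py; apply: nzy; apply: zmin; apply/asboolP.
have ltW a b : lt a b -> r a b by have /orP[//|] := rtot a b.
have wf_lt : well_founded lt.
  move=> x; apply: contrapT => nx; have [z [nz zmin]] := minP (fun x => ~ Acc lt x) (ex_intro _ x nx).
  by apply: nz; constructor => y /zmin /contrapT.
have lt_trans a b c : lt a b -> lt b c -> lt a c.
  move=> ab bc ca.
  pose P x := [\/ x = a, x = b | x = c].
  have [z [Pz zm]] := minP P (ex_intro _ a (Or31 _ _ erefl)).
  case: Pz => zE; subst z.
  - have [|ac] := pselect (lt c a); first by move=> /zm; apply; exact: Or33.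
    have rac : r a c by exact: contrapT.
    have ac' : a = c by apply: ranti; rewrite ca rac.
    by subst c; apply: bc; exact: ltW.
  - by apply: (zm _ ab); exact: Or31.
  - by apply: (zm _ bc); exact: Or32.
have lt_tot a b : [\/ lt a b, a = b | lt b a].
  have [ab|nab] := pselect (r a b); last exact: Or33.
  have [ba|nba] := pselect (r b a); last exact: Or31.
  by apply: Or32; apply: ranti; rewrite ab ba.
pose big (j : T) := exists g : T -> T, forall t, exists2 s, lt s j & g s = t.
have nbigP j : ~ big j -> forall g : T -> T, exists t, forall s, lt s j -> g s <> t.
  move=> nj g; apply: contrapT => ng; apply: nj; exists g => t.
  apply: contrapT => nt; apply: ng; exists t => s sj gs.
  by apply: nt; exists s.
have [exb|nb] := pselect (exists j, big j); last first.
  exists T, lt, id; split => //; first by move=> t; exists t.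
  by move=> j; apply: nbigP => bj; apply: nb; exists j.
have [t0 [[g gP] t0min]] := minP _ exb.
exists {s | lt s t0}, (fun a b => lt (sval a) (sval b)), (fun a => g (sval a)); split.
- move=> a.
  suff H x : Acc lt x -> forall b : {s | lt s t0}, sval b = x ->
      Acc (fun a b => lt (sval a) (sval b)) b by exact: (H _ (wf_lt (sval a))).
  elim=> {}x _ IH b bx; constructor => c.
  by move=> /= cb; apply: (IH (sval c)) => //; rewrite -bx.
- by move=> a b c; exact: lt_trans.
- move=> a b; have [ab|ab|ba] := lt_tot (sval a) (sval b); [exact: Or31| |exact: Or33].
  by apply: Or32; case: a b ab => [a pa] [b pb] /= ab; exact: eq_exist.
- by move=> t; have [s st0 gs] := gP t; exists (exist _ s st0).
- move=> j g'.
  have [t tP] := nbigP _ (t0min _ (svalP j)) (fun s =>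
    if pselect (lt s t0) is left h then g' (exist _ s h) else s).
  exists t => s sj; have := tP _ sj; case: pselect => [h|]; last by have := svalP s.
  by have -> : exist _ (sval s) h = s by case: s sj h => s ps sj h; exact: eq_exist.
Qed.

(** * The transfinite recursion *)

Section Construction.
Variable q : set_system nat.
Hypothesis qF : ProperFilter q.

(* There are as many rows as tasks, but rows are sequences of tasks: Koenig's
   diagonal argument then gives a row outside any union, over an initial segment
   of the tasks, of countable sets of rows. *)
Let T := nat -> set nat.
Let R := nat -> T.

Lemma code_exists : exists code : R -> set nat, injective code.
Proof.
exists (fun r => [set m | exists i j k, m = pickle (i, j, k) /\ r i j k]) => r s rs.
apply/funext => i; apply/funext => j; apply/predeqP => k.
have h (r' : R) : r' i j k <-> [set m | exists i j k, m = pickle (i, j, k) /\ r' i j k] (pickle (i, j, k)).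
  split; first by exists i, j, k.
  by move=> [i' [j' [k' [/(pcan_inj pickleK)[-> -> ->]]]]].
by rewrite (h r) (h s) rs.
Qed.

(* Constant tasks make the final filter an ultrafilter. *)
Lemma exists_admissible_done : exists F : set_system nat,
  UltraFilter F /\ forall U, task_done q U F.
Proof.
have [code code_inj] := code_exists.
have [J [lt [task [wf_lt lt_trans lt_tot task_surj small]]]] := small_well_order T.
pose st : Type := (set_system nat * set R)%type.
have /choice[nxt nxtP] (x : st * T) : exists s' : st,
    (forall C, countable C -> exists2 r, ~ x.1.2 r & ~ C r) ->
    admissible code x.1.2 x.1.1 ->
    [/\ x.1.1 `<=` s'.1, countable s'.2, admissible code (x.1.2 `|` s'.2) s'.1 &
      task_done q x.2 s'.1].
  have [fr|nfr] := pselect (forall C, countable C -> exists2 r, ~ x.1.2 r & ~ C r);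
    last by exists x.1 => /nfr.
  have [ad|nad] := pselect (admissible code x.1.2 x.1.1); last by exists x.1 => _ /nad.
  by have [F' [D' FD']] := admissible_stage qF x.2 fr ad; exists (F', D').
pose F0 : set_system nat := [set B | finite_set (~` B)].
(* The second component of a stage holds only the rows newly used there; [below j] gathers the rows
   and the filters of all earlier stages, and the cofinite sets. *)
pose below j (prev : forall s, lt s j -> st) : st :=
  ([set B | F0 B \/ exists s (h : lt s j), (prev s h).1 B],
   [set r | exists s (h : lt s j), (prev s h).2 r]).
pose rec j prev := nxt (@below j prev, task j).
pose S := Fix wf_lt (fun=> st) rec.
have SE j : S j = nxt (@below j (fun s _ => S s), task j).
  rewrite /S Fix_eq// => x f g fg; rewrite /rec; congr (nxt (_, _)).
  by congr (below _ _); apply: functional_extensionality_dep => s; apply/funext => h.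
pose Fb j := (@below j (fun s _ => S s)).1.
pose Db j := (@below j (fun s _ => S s)).2.
pose good j := [/\ Fb j `<=` (S j).1, countable (S j).2,
  admissible code (Db j `|` (S j).2) (S j).1 & task_done q (task j) (S j).1].
have mono j s : good j -> lt s j -> (S s).1 `<=` (S j).1.
  by move=> [Fbj _ _ _] sj B SB; apply: Fbj; right; exists s, sj.
have goodP j : good j.
  elim/(well_founded_ind wf_lt): j => j IH.
  rewrite /good SE.
  suff [fr ad] : (forall C, countable C -> exists2 r, ~ Db j r & ~ C r) /\
      admissible code (Db j) (Fb j).
    exact: (nxtP (@below j (fun s _ => S s), task j) fr ad).
  split.
    move=> C /(countable_enum (fun=> fun=> set0))[c cP].
    have /choice[rho rhoP] s : exists rho : nat -> R, lt s j -> (S s).2 `<=` range rho.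
      have [sj|nsj] := pselect (lt s j); last by exists (fun=> fun=> fun=> set0) => /nsj.
      have [_ cS _ _] := IH _ sj.
      by have [rho ?] := countable_enum (fun=> fun=> set0) cS; exists rho.
    (* The fresh row is built coordinatewise: at [2k+1] it differs from [c k], at [2k] from
       [rho s k] for all [s] below [j] at once, which [small] allows. *)
    have /choice[r rP] i : exists t : T,
        if odd i then c i./2 i <> t else forall s, lt s j -> rho s i./2 i <> t.
      have [oi|ei] := boolP (odd i); last exact: (small j (fun s => rho s i./2 i)).
      exists (fun n => ~` (c i./2 i n)) => /(congr1 (fun t => t 0)) e.
      have n0 : ~ c i./2 i 0 0 by move=> h; have := h; rewrite e; apply.
      by apply: (n0); rewrite e.
    exists r.
      move=> [s [sj /(rhoP s sj)[k _ rk]]].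
      have := rP k.*2; rewrite odd_double doubleK => /(_ s sj).
      by rewrite rk.
    move=> /cP[k _ rk].
    have := rP k.*2.+1; rewrite /= odd_double /= uphalf_double.
    by rewrite rk.
  (* [None] stands for the cofinite filter, which keeps the union nonempty when no stage precedes
     [j]. *)
  pose Fo (o : option {s | lt s j}) := if o is Some s then (S (sval s)).1 else F0.
  pose Do (o : option {s | lt s j}) :=
    if o is Some s then Db (sval s) `|` (S (sval s)).2 else set0.
  have -> : Fb j = \bigcup_o Fo o.
    apply/predeqP => B; split=> [[F0B|[s [sj SB]]]|[[[s sj]|] _ SB]].
    - by exists None.
    - by exists (Some (exist _ s sj)).
    - by right; exists s, sj.
    - by left.
  apply: (@admissible_union _ code _ None Fo Do).
  - move=> [[s sj]|] [[s' sj']|].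
    + have [ss'|ss'|s's] := lt_tot s s'.
      * by exists (Some (exist _ s' sj')); split => //; exact/mono/ss'/IH.
      * by exists (Some (exist _ s' sj')); split => //; rewrite /= ss'.
      * by exists (Some (exist _ s sj)); split => //; exact/mono/s's/IH.
    + by exists (Some (exist _ s sj)); split => // B F0B; have [+ _ _ _] := IH _ sj; apply; left.
    + by exists (Some (exist _ s' sj')); split => // B F0B; have [+ _ _ _] := IH _ sj'; apply; left.
    + by exists None; split.
  - move=> [[s sj]|]; last exact: admissible_cofinite.
    by have [_ _] := IH _ sj.
  - move=> [[s sj]|] // r [[s' [s's Sr]]|Sr]; last by exists s, sj.
    by exists s'; exists (lt_trans _ _ _ s's sj).
have [j0 _] := task_surj (fun=> set0).
have aF : admissible code setT (\bigcup_j (S j).1).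
  apply: (@admissible_union _ code _ j0 (fun j => (S j).1) (fun j => Db j `|` (S j).2)) => //.
    move=> i j; have [ij|->|ji] := lt_tot i j.
    - by exists j; split => //; exact: mono.
    - by exists j; split.
    - by exists i; split => //; exact: mono.
  by move=> j; have [_ _] := goodP j.
have PF := admissible_proper aF.
have doneU U : task_done q U (\bigcup_j (S j).1).
  have [j tj] := task_surj U; have [_ _ _] := goodP j; rewrite tj => -[dec lnk [V SV qV]].
  have sub : (S j).1 `<=` \bigcup_j (S j).1 by move=> B SB; exists j.
  split; last by exists V => //; exact: sub.
    by move=> n; have [] := dec n; [left|right]; exact: sub.
  move=> FU.
  have SU n : (S j).1 (U n).
    have [//|/sub nU] := dec n.
    by have [x []] := filter_ex (filterI (FU n) nU).
  move=> U0 Ud _; have [W SW WP] := lnk SU U0 Ud SU.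
  by exists W => // Y; exact: sub.
exists (\bigcup_j (S j).1); split => //; split => // G PG FG.
apply/seteqP; split => // A GA.
have [/(_ 0)[//|nA] _ _] := doneU (fun=> A).
by have [x []] := filter_ex (filterI GA (FG _ nA)).
Qed.

(** Choose [W n] in [p] but not in [a n], and apply the OK property to the intersections [U n]. If
    every [V Y] were in some [a n], one [n] would serve infinitely many of the uncountably many [Y].
    Then [a n] contains the meet of [n.+1] of these [V Y], which is finite outside [U n.+1]; but
    [a n] is free and omits [U n.+1], a subset of [W n]. *)
Lemma exists_weak_P_ultrafilter : exists p : set_system nat, [/\ UltraFilter p,
  forall f : nat -> nat, exists2 V, p V & ~ q (f @^-1` V) &
  forall a : nat -> set_system nat, (forall n, UltraFilter (a n)) ->
    (forall n k, ~ a n [set k]) -> (forall n, a n <> p) ->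
    exists2 V, p V & forall n, ~ a n V].
Proof.
have [p [pU pdone]] := exists_admissible_done.
exists p; split => // [f|a aU anp ap].
  have [_ _ [V pV qV]] := pdone (fun n => [set f n]).
  exists V => //; suff -> : f = (fun n => xget 0 [set f n]) by [].
  by apply/funext => n; case: xgetP => [m -> //|/(_ (f n))[]].
have /choice[W WP] n : exists W, p W /\ ~ a n W.
  apply: contrapT => nW; apply: (ap n); apply: max_filter => W pW.
  by apply: contrapT => naW; apply: nW; exists W.
pose U n := \bigcap_(i in `I_n) W i.
have pU' n : p (U n) by apply: filter_bigI_nat => i _; have [] := WP i.
have U0 : U 0 = setT by apply/seteqP; split.
have Ud n : U n.+1 `<=` U n by move=> x Ux i /= ilt; apply: Ux => /=; exact: ltnW.
have [_ /(_ pU')/(_ U0 Ud pU')[V pV VP] _] := pdone U.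
apply: contrapT => nV.
have /choice[N NP] Y : exists n, a n (V Y).
  by apply: contrapT => nY; apply: nV; exists (V Y) => // n aV; apply: nY; exists n.
have [n inf] : exists n, infinite_set [set Y | N Y = n].
  apply: contrapT => fin; apply: uncountable_powerset.
  have -> : [set: set nat] = \bigcup_n [set Y | N Y = n].
    by apply/seteqP; split => // Y _; exists (N Y).
  apply: bigcup_countable => // n _; apply: finite_set_countable.
  by apply: contrapT => nf; apply: fin; exists n.
have [Y Yinj YN] := infinite_seq inf.
have aVn : a n (\bigcap_(i in `I_n.+1) V (Y i)).
  by apply: filter_bigI_nat => i _; rewrite -(YN i).
have [aUn|anUn] := in_ultra_setVsetC (U n.+1) (aU n).
  by have [_] := WP n; apply; apply: filterS aUn => x; apply; exact: ltnSn.
by apply: (ultra_finite (aU n) (anp n) (VP Y Yinj n)); exact: filterI.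
Qed.

End Construction.


Lemma countable_image_nat (T : Type) (c : nat -> T) (A : set nat) : countable (c @` A).
Proof. by apply: card_le_trans (card_image_le _ _) _; exact: countableP. Qed.

(** * Discrete sequences in R2-spaces *)

Section ExpandedSequences.
Variable X : topologicalType.

Definition expanded (c : nat -> X) (O : nat -> set X) :=
  [/\ forall n, open (O n), forall n, O n (c n) &
      forall m n x, O m x -> O n x -> m = n].

(** Open pieces are split off one by one, leaving an infinite open rest. Given two points of [U]
    with disjoint neighbourhoods [A] and [B], either [A] can be split off, or only finitely many
    points of [U] lie outside the closure of [A], so that the point in [B] is isolated. *)
Lemma expanded_exists : hausdorff_space X -> infinite_set [set: X] ->
  exists c O, expanded c O.
Proof.
move=> hX infX.
have T1 (x : X) : open (~` [set x]).
  by rewrite openC; apply: accessible_closed_set1; exact: hausdorff_accessible.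
have split_open (U : set X) : open U -> infinite_set U ->
    exists x W U', [/\ open W /\ W x, W `<=` U, open U' /\ infinite_set U',
                       U' `<=` U & W `&` U' = set0].
  move=> oU infU; have [f finj fU] := infinite_seq infU.
  have ab : f 0 != f 1 by apply/eqP => /finj.
  have := hX; rewrite open_hausdorff => /(_ _ _ ab)[[A B] /=].
  rewrite !inE => -[Aa Bb] [oA oB AB].
  have [finA|infA] := pselect (finite_set (U `\` closure A)); last first.
    exists (f 0), (A `&` U), (U `\` closure A); split.
    - by split; [exact: openI|split => //; exact: fU].
    - by move=> x [].
    - by split => //; apply: openI => //; rewrite openC; exact: closed_closure.
    - by move=> x [].
    - apply/seteqP; split => // x [[Ax Ux] [_]]; apply; exact: subset_closure.
  have BA : B `<=` ~` closure A.
    move=> x Bx /(_ B) []; first by apply: open_nbhs_nbhs.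
    by move=> y [Ay By]; suff : (@set0 X) y by []; rewrite -AB.
  have finB : finite_set (B `&` U).
    by apply: sub_finite_set finA => x [/BA].
  have o1 : open [set f 1].
    have -> : [set f 1] = (B `&` U) `&` ~` ((B `&` U) `\ f 1).
      apply/seteqP; split => [_ ->|x [BUx Vx]]; first by split => [|[_]]; [split|exact].
      by apply: contrapT => x1; apply: Vx.
    apply: openI; first exact: openI.
    rewrite openC; apply: (accessible_finite_set_closed.1 (hausdorff_accessible hX)).
    exact: finite_setD.
  exists (f 1), [set f 1], (U `\ f 1); split.
  - by split.
  - by move=> _ ->; exact: fU.
  - split; first by rewrite setDE; exact: openI.
    by apply: infinite_setD => //; exact: finite_set1.
  - by move=> x [].
  - by apply/seteqP; split => // x [/= -> []].
pose st := (X * set X * set X)%type.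
have /choice[nxt nxtP] (U : set X) : exists s : st, open U -> infinite_set U ->
    [/\ open s.1.2 /\ s.1.2 s.1.1, s.1.2 `<=` U, open s.2 /\ infinite_set s.2,
        s.2 `<=` U & s.1.2 `&` s.2 = set0].
  have [[oU iU]|nU] := pselect (open U /\ infinite_set U).
    by have [x [W [U' H]]] := split_open U oU iU; exists (x, W, U').
  have [x _] := infinite_setN0 infX.
  by exists (x, setT, setT) => oU iU; exfalso; apply: nU.
pose U n := iter n (fun V => (nxt V).2) setT.
have UP n : open (U n) /\ infinite_set (U n).
  elim: n => [|n [oU iU]]; first by split => //; exact: openT.
  by have [_ _] := nxtP _ oU iU.
have Umono m n : (m <= n)%N -> U n `<=` U m.
  move=> /subnKC <-; elim: (n - m)%N => [|k IHk]; first by rewrite addn0.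
  rewrite addnS; apply: subset_trans IHk; have [oU iU] := UP (m + k)%N.
  by have [_ _ _] := nxtP _ oU iU.
have dis m n x : (m < n)%N -> (nxt (U m)).1.2 x -> (nxt (U n)).1.2 x -> False.
  move=> mn mx nx; have [oU iU] := UP m; have [_ _ _ _ W0] := nxtP _ oU iU.
  have [oUn iUn] := UP n; have [_ WU _ _ _] := nxtP _ oUn iUn.
  suff : (@set0 X) x by []; rewrite -W0; split => //.
  by apply: (Umono _ _ mn); exact: WU.
exists (fun n => (nxt (U n)).1.1), (fun n => (nxt (U n)).1.2); split.
- by move=> n; have [oU iU] := UP n; have [[]] := nxtP _ oU iU.
- by move=> n; have [oU iU] := UP n; have [[]] := nxtP _ oU iU.
- move=> m n x mx nx; have [mn|nm|//] := ltngtP m n.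
  + by have := dis _ _ _ mn mx nx.
  + by have := dis _ _ _ nm nx mx.
Qed.

Hypothesis XR2 : R2_space X.
Variables (c : nat -> X) (O : nat -> set X).
Hypothesis cO : expanded c O.

Lemma expanded_discrete (A : set nat) : discrete_set (c @` A).
Proof.
have [oO Oc O1] := cO => U.
exists (\bigcup_(n in [set n | exists2 x, U x & set_val x = c n]) O n).
  by apply: bigcup_open => n _.
apply/seteqP; split => [x [n [y Uy yn] /= Onx]|x Ux].
  suff : x = y by move=> ->.
  apply: val_inj; rewrite /= -[RHS]/(set_val y) yn.
  have [m _ mx] := set_valP x.
  have mn : m = n by apply: O1 Onx; have := Oc m; rewrite mx.
  by rewrite -mn mx.
have [m Am mx] := set_valP x.
by exists m; [exists x; rewrite ?mx|have := Oc m; rewrite mx].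
Qed.

Lemma expanded_R2 (A : set nat) (Z : set X) : countable Z ->
  Z `&` closure (c @` A) = set0 -> (forall n z, A n -> Z z -> ~ O n z) ->
  closure Z `&` closure (c @` A) = set0.
Proof.
have [oO Oc O1] := cO => cZ ZA AZ.
apply: XR2 => //; [exact: countable_image_nat| |by right; exact: expanded_discrete].
split => //; apply/seteqP; split => // x [clZ [n An nE]]; move: clZ; rewrite -nE.
move=> /(_ (O n)) []; first exact: open_nbhs_nbhs.
by move=> z [Zz Onz]; apply: (AZ n z).
Qed.

Lemma expanded_notin_closure (A : set nat) k z : O k z -> ~ A k ->
  ~ closure (c @` A) z.
Proof.
have [oO Oc O1] := cO => Okz nAk /(_ (O k)) []; first exact: open_nbhs_nbhs.
by move=> _ [[n An <-] Okn]; apply: nAk; rewrite (O1 _ _ _ Okn (Oc n)).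
Qed.

Lemma expanded_closure_disjoint (A B : set nat) :
  A `&` B = set0 -> closure (c @` A) `&` closure (c @` B) = set0.
Proof.
have [oO Oc O1] := cO => AB; apply: expanded_R2.
- exact: countable_image_nat.
- apply/seteqP; split => // _ [[n An <-]].
  apply: (@expanded_notin_closure _ n) => // Bn.
  by suff : (@set0 nat) n by []; rewrite -AB.
- move=> n _ Bn [m Am <-] Onm; suff : (@set0 nat) n by [].
  by rewrite -AB; split => //; rewrite (O1 _ _ _ Onm (Oc m)).
Qed.

End ExpandedSequences.

(** * Limits along [q] and along [p] *)

Section Isolated.
Variable q : set_system nat.
Hypothesis qU : UltraFilter q.

Definition q_isolated (X : topologicalType) (x : X) := forall z : nat -> X,
  z @ q --> x -> q [set n | z n = x].

Lemma cvg_closure (X : topologicalType) (F : set_system nat) {FF : ProperFilter F}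
    (z : nat -> X) x (A : set nat) :
  z @ F --> x -> F A -> closure (z @` A) x.
Proof.
move=> zx FA V xV.
by have [n [An Vn]] := filter_ex (filterI FA (zx V xV : F (z @^-1` V))); exists (z n); split => //; exists n.
Qed.

Lemma weak_P_point_isolated (X : topologicalType) (x : X) :
  weak_P_point x -> q_isolated x.
Proof.
move=> wx z zx; have [//|nz] := in_ultra_setVsetC [set n | z n = x] qU.
exfalso; apply: (wx (z @` (~` [set n | z n = x]))).
- exact: countable_image_nat.
- by move=> _ [n /= nzx <-].
- exact: (cvg_closure zx nz).
Qed.

Variable p : set_system nat.
Hypothesis pU : UltraFilter p.
Hypothesis p_image : forall f : nat -> nat, exists2 V, p V & ~ q (f @^-1` V).
Hypothesis p_weak : forall a : nat -> set_system nat, (forall n, UltraFilter (a n)) ->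
    (forall n k, ~ a n [set k]) -> (forall n, a n <> p) ->
    exists2 V, p V & forall n, ~ a n V.

(** Suppose [z n <> x] for [q]-many [n]. If [z n] is in [O (g n)], use that [p] is not the image of
    [q] under [g]. If it is outside all [O k] and outside the closure of [c], R2 applies directly.
    Otherwise [z n] is a limit of [c] along a free ultrafilter other than [p], and [p_weak] yields a
    [V] in [p] omitted by all of these. In each case [x] would lie in two disjoint closures. *)
Lemma expanded_limit_isolated (X : topologicalType) (c : nat -> X) O (x : X) :
  hausdorff_space X -> R2_space X -> expanded c O -> c @ p --> x -> q_isolated x.
Proof.
move=> hX XR2 cO cx z zx; have [oO Oc O1] := cO.
have cnt (A : set nat) : countable (z @` A).
  exact: countable_image_nat.
have [//|nz] := in_ultra_setVsetC [set n | z n = x] qU; exfalso.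
have meet A B : q A -> p B -> closure (z @` A) `&` closure (c @` B) = set0 -> False.
  move=> qA pB AB; suff : (@set0 X) x by []; rewrite -AB.
  by split; [exact: (cvg_closure zx qA)|exact: (cvg_closure cx pB)].
pose A1 := [set n | exists k, O k (z n)].
have [qA1|qA1] := in_ultra_setVsetC A1 qU.
  have /choice[g gP] n : exists k, A1 n -> O k (z n).
    by have [[k Ok]|nA] := pselect (A1 n); [exists k|exists 0 => /nA].
  have [V pV nqV] := p_image g.
  have [//|qV] := in_ultra_setVsetC (g @^-1` V) qU.
  apply: (meet _ _ (filterI qA1 qV) pV); apply: (expanded_R2 XR2 cO) => //.
    apply/seteqP; split => // _ [[n [A1n /= nV] <-]].
    exact: (expanded_notin_closure cO (gP n A1n)).
  by move=> k _ Vk [n [A1n /= nV] <-] Okn; apply: nV; rewrite (O1 _ _ _ (gP n A1n) Okn).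
pose A2 := [set n | closure (range c) (z n)].
have [qA2|qA2] := in_ultra_setVsetC A2 qU; last first.
  apply: (meet _ setT (filterI qA1 qA2)); first exact: filterT.
  apply: (expanded_R2 XR2 cO) => //.
    by apply/seteqP; split => // _ [[n [_ /= nA] <-]].
  by move=> k _ _ [n [/= nA _] <-] Okn; apply: nA; exists k.
pose A3 := (~` [set n | z n = x]) `&` ((~` A1) `&` A2).
have qA3 : q A3 by exact: filterI nz (filterI qA1 qA2).
have lim_uf n : A3 n -> exists a : set_system nat, UltraFilter a /\ c @ a --> z n.
  move=> [_ [_ A2n]].
  pose G : set_system nat := [set S | exists2 V, nbhs (z n) V & c @^-1` V `<=` S].
  have PG : ProperFilter G.
    apply: Build_ProperFilter_ex => [S [V nV VS]|].
      by have [_ [[k _ <-] Vk]] := A2n _ nV; exists k; exact: VS.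
    split; first by exists setT => //; exact: filterT.
      move=> S S' [V nV VS] [V' nV' VS']; exists (V `&` V'); first exact: filterI.
      by move=> k [/VS ? /VS'].
    by move=> S S' SS' [V nV VS]; exists V => // k /VS /SS'.
  have [a [aU Ga]] := ultraFilterLemma PG.
  by exists a; split => // V nV; apply: Ga; exists V.
have [n0 A3n0] := filter_ex qA3.
(* Indices outside [A3] borrow an ultrafilter from [n0], because [p_weak] asks for a full
   sequence. *)
have /choice[a aP] n : exists a : set_system nat, exists2 m, A3 m &
    (A3 n -> m = n) /\ (UltraFilter a /\ c @ a --> z m).
  have [A3n|nA3] := pselect (A3 n).
    by have [a ?] := lim_uf n A3n; exists a, n.
  by have [a ?] := lim_uf n0 A3n0; exists a, n0.
have [n|n k ak|n ap|V pV aV] := p_weak (a := a).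
- by have [m _ [_ []]] := aP n.
- have [m [_ [nA1 _]] [_ [aU az]]] := aP n; apply: nA1; exists k.
  suff -> : z m = c k by [].
  have : closure (c @` [set k]) (z m) by exact: (cvg_closure az ak).
  rewrite image_set1 -(closure_id _).1 //.
  by apply: accessible_closed_set1; exact: hausdorff_accessible.
- have [m [nzx _] [_ [aU az]]] := aP n; apply: nzx.
  rewrite ap in az.
  exact: (cvg_unique hX az cx).
have A3V : z @` A3 `<=` closure (c @` (~` V)).
  move=> _ [n A3n <-]; have [m _ [/(_ A3n) mn [aU az]]] := aP n; subst m.
  have [/aV //|naV] := in_ultra_setVsetC V aU.
  exact: (cvg_closure az naV).
suff : (@set0 X) x by [].
rewrite -(expanded_closure_disjoint XR2 cO (setICl V)); split.
  have /closure_id -> := @closed_closure _ (c @` (~` V)).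
  by apply: closure_subset A3V _ _; exact: (cvg_closure zx qA3).
exact: (cvg_closure cx pV).
Qed.

End Isolated.


Lemma infinite_range (T : Type) (f : nat -> T) : injective f -> infinite_set (range f).
Proof.
move=> finj /(finite_preimage (f := f)) H; apply: infinite_nat.
by apply: sub_finite_set (H _) => [n _|i j _ _ /finj//]; exists n.
Qed.

(* If no block of a partition of [nat] into infinite blocks is good for
   infinitely many of its points, take a point [i n] hit by its own block in every
   block [n]: it cannot be hit by the rest of the transversal. *)
Lemma infinite_unhit (hits : nat -> set nat -> Prop) :
  (forall i S S', S `<=` S' -> hits i S -> hits i S') ->
  (forall i S S', hits i (S `|` S') -> hits i S \/ hits i S') ->
  (forall i S S', hits i S -> hits i S' -> S `&` S' !=set0) ->
  (forall i, ~ hits i [set i]) ->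
  exists2 I : set nat, infinite_set I & forall i, I i -> ~ hits i I.
Proof.
move=> hmono hU hI h1.
pose P (n : nat) := range (fun j : nat => pickle (n, j)).
have Pinf n : infinite_set (P n).
  by apply: infinite_range => j k /(pcan_inj pickleK)[].
have Pdis m n i : P m i -> P n i -> m = n.
  by move=> [j _ <-] [k _ /(pcan_inj pickleK)[]].
have [[n infn]|fin] := pselect (exists n, infinite_set [set i | P n i /\ ~ hits i (P n)]).
  eexists; first exact: infn.
  move=> i [Pi nPi] hi; apply: nPi; apply: hmono hi => j [].
  by [].
have /choice[i iP] n : exists i, P n i /\ hits i (P n).
  apply: contrapT => ni; apply: fin; exists n.
  apply: sub_infinite_set (Pinf n) => i Pi; split => // hi.
  by apply: ni; exists i.
have iinj : injective i.
  by move=> m n imn; apply: (Pdis _ _ (i m)); [have [] := iP m|rewrite imn; have [] := iP n].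
exists (range i); first exact: infinite_range.
move=> _ [n _ <-] hi; have [Pn hn] := iP n.
have : hits (i n) ((range i `\ i n) `|` [set i n]).
  by apply: hmono hi => k ik; have [->|kn] := pselect (k = i n); [right|left].
move=> /hU[hi'|/h1//].
have [k [Pk [[m _ mk] /= kn]]] := hI _ _ _ hn hi'.
apply: kn; rewrite -mk; congr i; apply: (Pdis _ _ k) => //.
by rewrite -mk; have [] := iP m.
Qed.

Lemma expanded_separate (X : topologicalType) (c : nat -> X) O (d : nat -> X) :
  hausdorff_space X -> R2_space X -> expanded c O -> (forall n, d n <> c n) ->
  exists2 I : set nat, infinite_set I & closure (d @` I) `&` closure (c @` I) = set0.
Proof.
move=> hX XR2 cO0 dc.
have cl1 (x : X) : closed [set x].
  by apply: accessible_closed_set1; exact: hausdorff_accessible.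
(* Shrinking [O n] to miss [d n] ensures that the index [n] is not hit by [n] alone. *)
have [U cO Ud] : exists2 U, expanded c U & forall n, ~ U n (d n).
  exists (fun n => O n `&` ~` [set d n]); last by move=> n [_]; exact.
  have [oO Oc O1] := cO0; split => [n|n|m n x [Om _] [On _]].
  - by apply: openI => //; rewrite openC.
  - by split => // /esym /dc.
  - exact: O1 Om On.
have [oU Uc U1] := cO.
(* [hits i S] means that [d i] obstructs the use of R2 against [c] on [S]. Disjoint index sets are
   not both hit by one [i], as their neighbourhoods and, by R2, their closures are disjoint. *)
pose hits i S := (exists2 k, S k & U k (d i)) \/ closure (c @` S) (d i).
have [||||I infI IP] := @infinite_unhit hits.
- move=> i S S' SS' [[k Sk Uk]|cl]; first by left; exists k => //; exact: SS'.
  by right; apply: closure_subset cl; exact: image_subset.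
- move=> i S S' [[k [Sk|Sk] Uk]|].
  + by left; left; exists k.
  + by right; left; exists k.
  + by rewrite image_setU closureU => -[cl|cl]; [left|right]; right.
- move=> i S S' [[k Sk Uk]|cS] [[k' Sk' Uk']|cS'].
  + by exists k; split => //; rewrite (U1 _ _ _ Uk Uk').
  + exists k; split => //; apply: contrapT => nk.
    exact: (expanded_notin_closure cO Uk nk cS').
  + exists k'; split => //; apply: contrapT => nk.
    exact: (expanded_notin_closure cO Uk' nk cS).
  + apply/set0P/eqP => SS'; suff : (@set0 X) (d i) by [].
    by rewrite -(expanded_closure_disjoint XR2 cO SS').
- move=> i [[k -> //]|]; first exact: Ud.
  by rewrite image_set1 -(closure_id _).1 //= => /dc.
- exists I => //; apply: (expanded_R2 XR2 cO) => //.
  + exact: countable_image_nat.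
  + apply/seteqP; split => // x [[i Ii dx] cx]; apply: (IP i Ii); right.
    by rewrite dx.
  + by move=> n x In [i Ii <-] Un; apply: (IP i Ii); left; exists n.
Qed.

Lemma nonprincipal_exists (I : set nat) : infinite_set I ->
  exists u : set_system nat, [/\ UltraFilter u, u I & forall k, ~ u [set k]].
Proof.
move=> infI.
pose G : set_system nat := [set S | finite_set (I `\` S)].
have PG : ProperFilter G.
  apply: Build_ProperFilter_ex => [S fS|].
    have /infinite_setN0[k [Ik nk]] := infinite_setD infI fS.
    by exists k; apply: contrapT => nS; apply: nk.
  split; first by rewrite /G /= setDT; exact: finite_set0.
    move=> S S' fS fS'; rewrite /G /=.
    apply: (@sub_finite_set _ _ ((I `\` S) `|` (I `\` S'))); last by rewrite finite_setU.
    by move=> k [Ik /not_andP[nS|nS]]; [left|right].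
  by move=> S S' SS' /=; apply: sub_finite_set; exact: setDS.
have [u [uU Gu]] := ultraFilterLemma PG.
exists u; split => //; first by apply: Gu; rewrite /G /= setDv; exact: finite_set0.
move=> k uk.
have unk : u (~` [set k]).
  apply: Gu; rewrite /G /= setDE setCK.
  by apply: sub_finite_set (finite_set1 k); exact: subIsetr.
by have [n []] := filter_ex (filterI uk unk).
Qed.

Lemma fmap_ultra (S T : Type) (m : S -> T) (u : set_system S) :
  UltraFilter u -> UltraFilter (m @ u).
Proof.
move=> uU; split; first exact: fmap_proper_filter.
move=> G GP uG; apply/seteqP; split; last exact: uG.
move=> A GA; have [//|nA] := in_ultra_setVsetC (m @^-1` A) uU.
have /uG GnA : (m @ u) (~` A) by [].
by have [n []] := filter_ex (filterI GA GnA).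
Qed.

Lemma ultra_cofinite (u : set_system nat) (S : set nat) :
  UltraFilter u -> (forall k, ~ u [set k]) -> finite_set (~` S) -> u S.
Proof.
move=> uU unp fS; have [//|unS] := in_ultra_setVsetC S uU.
by case: (ultra_finite uU unp fS).
Qed.

(** * Continuous functions on products *)

Section Products.
Variables (kappa : Type) (X : kappa -> topologicalType).
Local Notation PX := (prod_topology X).

Lemma prod_cvgP (F : set_system PX) (w : PX) {FF : Filter F} :
  (F --> w) <-> forall a (V : set (X a)), nbhs (w a) V -> F [set w' | V (w' a)].
Proof.
split.
  move=> /cvg_sup Fw a V wV; apply: (Fw a).
  exists [set w' : PX | V^° (w' a)]; split; last by move=> w' /=; exact: interior_subset.
    by exists V^° => //; exact: open_interior.
  exact: wV.
move=> H; apply/cvg_sup => a U [V [[W oW <-] /= Ww] WU].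
apply: filterS WU _; apply: H; exact: open_nbhs_nbhs.
Qed.

Lemma prod_proj_continuous a : continuous ((fun w => w a) : PX -> X a).
Proof. by move=> w V wV; have /prod_cvgP H : nbhs w --> w := cvg_id; exact: H. Qed.

Lemma prod_nbhs_finite (w : PX) (V : set PX) : nbhs w V ->
  exists2 F : set kappa, finite_set F & forall w' : PX, (forall a, F a -> w' a = w a) -> V w'.
Proof.
(* It suffices that this filter, whose members are the sets admitting such an [F], converges to
   [w]. *)
pose G : set_system PX := [set V | exists2 F : set kappa, finite_set F &
  forall w' : PX, (forall a, F a -> w' a = w a) -> V w'].
have GF : Filter G.
  split; first by exists set0.
    move=> P Q [F fF FP] [F' fF' FQ]; exists (F `|` F'); first by rewrite finite_setU.
    by move=> w' ww'; split; [apply: FP|apply: FQ] => a Fa; apply: ww'; [left|right].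
  by move=> P Q PQ [F fF FP]; exists F => // w' /FP /PQ.
suff : G --> w by exact.
apply/prod_cvgP => a U wU; exists [set a]; first exact: finite_set1.
by move=> w' /(_ a erefl) /= ->; exact: nbhs_singleton.
Qed.

Variables (Y : topologicalType) (f : PX -> Y) (c : nat -> Y) (O : nat -> set Y)
  (z : nat -> PX).
Hypotheses (hY : hausdorff_space Y) (YR2 : R2_space Y) (cO : expanded c O).
Hypotheses (fc : continuous f) (fz : forall n, f (z n) = c n).
Hypothesis zlim : forall u : set_system nat, UltraFilter u -> exists l : PX, z @ u --> l.

(* Otherwise there are points [w_i] with [f (w_i) <> c (m_i)] such that in every
   coordinate [w_i] and [z (m_i)] agree for almost all [i], so that [f (w_i)] and
   [c (m_i)] have the same limits along every free ultrafilter. *)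
Lemma finitely_determined : exists (F : set kappa) (N : nat), finite_set F /\
  forall n w, (N <= n)%N -> (forall a, F a -> w a = z n a) -> f w = c n.
Proof.
apply: contrapT => nF.
have /choice[s sP] (x : set kappa * nat) : exists s : nat * PX * set kappa,
    finite_set x.1 -> [/\ (x.2 <= s.1.1)%N, finite_set s.2,
      forall a, x.1 a \/ ~ s.2 a -> s.1.2 a = z s.1.1 a & f s.1.2 <> c s.1.1].
  case: x => F N /=; have [fF|infF] := pselect (finite_set F); last first.
    by exists (0, z 0, set0) => /infF.
  apply: contrapT => ns; apply: nF; exists F, N; split => // n w Nn wz.
  apply: contrapT => fw; apply: ns.
  have [|F' fF' F'V] := @prod_nbhs_finite w (f @^-1` (~` [set c n])).
    apply: fc; apply: open_nbhs_nbhs; split => //; rewrite openC.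
    by apply: accessible_closed_set1; exact: hausdorff_accessible.
  exists (n, (fun a => if pselect (F' a) then w a else z n a) : PX, F') => _; split => //=.
    by move=> a aF; case: pselect => [F'a|//]; case: aF => // Fa; exact: wz.
  by apply: F'V => a F'a; case: pselect.
pose g := fix g i : set kappa * nat :=
  if i is j.+1 then let s := s (g j) in ((g j).1 `|` s.2, s.1.1.+1) else (set0, 0).
pose m i := (s (g i)).1.1; pose w i := (s (g i)).1.2.
have gfin i : finite_set (g i).1.
  elim: i => [|i IHi] /=; first exact: finite_set0.
  by rewrite finite_setU; split => //; have [_ + _ _] := sP _ IHi.
have gmono i j : (i <= j)%N -> (g i).1 `<=` (g j).1.
  move=> /subnKC <-; elim: (j - i)%N => [|k IHk]; first by rewrite addn0.
  by rewrite addnS => a /IHk /= ga; left.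
have m_lt i j : (i < j)%N -> (m i < m j)%N.
  have mS k : (m k < m k.+1)%N by have [+ _ _ _] := sP _ (gfin k.+1).
  elim: j => // j IHj; rewrite ltnS leq_eqVlt => /orP[/eqP -> //|/IHj ij].
  exact: ltn_trans ij (mS j).
have minj : injective m.
  move=> i j mij; have [ij|ji|//] := ltngtP i j.
    by have := m_lt _ _ ij; rewrite mij ltnn.
  by have := m_lt _ _ ji; rewrite mij ltnn.
have cmO : expanded (c \o m) (O \o m).
  have [oO Oc O1] := cO; split => [n|n|i j x /= mi mj]; [exact: oO|exact: Oc|].
  by apply: minj; exact: O1 mi mj.
have [|I infI clI] := expanded_separate (d := f \o w) hY YR2 cmO.
  by move=> i; have [_ _ _] := sP _ (gfin i).
have [u [uU uI unp]] := nonprincipal_exists infI.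
have [l zl] := zlim (fmap_ultra m uU).
have wl : w @ u --> l.
  apply/prod_cvgP => a V lV.
  have zV : u [set i | V (z (m i) a)].
    by move/prod_cvgP : (zl) => /(_ a V lV).
  have eqa : u [set i | w i a = z (m i) a].
    apply: ultra_cofinite => //.
    have [[j gja]|na] := pselect (exists j, (g j).1 a).
      apply: (@sub_finite_set _ _ `I_j); last exact: finite_II.
      move=> i /= wz; rewrite ltnNge; apply/negP => ji; apply: wz.
      by have [_ _ + _] := sP _ (gfin i); apply; left; exact: gmono gja.
    apply: (@sub_finite_set _ _ set0); last exact: finite_set0.
    move=> i /= wz; apply: wz; have [_ _ + _] := sP _ (gfin i); apply; right => sa.
    by apply: na; exists i.+1; right.
  suff : u [set i | V (w i a)] by [].
  by apply: filterS (filterI zV eqa) => i [Vz e]; rewrite /= (e : w i a = z (m i) a).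
suff : (@set0 Y) (f l) by [].
rewrite -clI; split.
  have fw : (f \o w) @ u --> f l by apply: cvg_comp wl _; exact: fc.
  exact: (cvg_closure fw uI).
have cm : (c \o m) @ u --> f l.
  have -> : c \o m = f \o z \o m by apply/funext => i; rewrite /= fz.
  by apply: cvg_comp zl _; exact: fc.
exact: (cvg_closure cm uI).
Qed.

End Products.


(** * Maps on βω *)

Lemma beta_ext (u v : beta_omega) : beta_filter u = beta_filter v -> u = v.
Proof.
case: u v => [F FU] [G GU] /= FG; case: _ / FG in GU *.
by rewrite (Prop_irrelevance FU GU).
Qed.

Lemma beta_neq (u v : beta_omega) : u <> v ->
  exists2 C, beta_filter u C & beta_filter v (~` C).
Proof.
move=> uv; apply: contrapT => nC; apply: uv; apply: beta_ext; apply: esym.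
apply: max_filter => C uC; have [//|nvC] := in_ultra_setVsetC C (beta_ultra v).
by case: nC; exists C.
Qed.

Lemma beta_cvg (K : topologicalType) (g : beta_omega -> K) u :
  continuous g -> (g \o beta_inj) @ beta_filter u --> g u.
Proof. by move=> gc; apply: cvg_comp (@beta_inj_cvg u) _; exact: gc. Qed.

Lemma beta_extend (K : topologicalType) (c : nat -> K) :
  compact [set: K] -> hausdorff_space K ->
  exists2 g : beta_omega -> K, continuous g & forall n, g (beta_inj n) = c n.
Proof.
move=> cK hK; have [_ _ _ H] := beta_omega_stone_cech.
have cc : continuous c.
  move=> n V nV; have nn : nbhs (n : nat) [set n] by exact: discrete_set1.
  by apply: (filterS _ nn) => _ ->; exact: nbhs_singleton nV.
have [g [[gc gE] _]] := H K c cK hK cc.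
by exists g => // n; rewrite -gE.
Qed.

Lemma beta_eq (K : topologicalType) (g h : beta_omega -> K) u :
  hausdorff_space K -> continuous g -> continuous h ->
  beta_filter u [set n | g (beta_inj n) = h (beta_inj n)] -> g u = h u.
Proof.
move=> hK gc hc gh; apply: (cvg_unique hK (beta_cvg (u := u) gc)).
move=> V /(beta_cvg hc) /= hV.
suff : beta_filter u [set n | V (g (beta_inj n))] by [].
by apply: filterS (filterI gh hV) => n [/= -> ?].
Qed.

(* For [s : nat -> beta_omega], [r u] is the limit of [s] along [u]. *)
Definition beta_sum (s : nat -> beta_omega) (r : beta_omega -> beta_omega) :=
  [/\ continuous r, forall n, r (beta_inj n) = s n &
      forall u S, beta_filter (r u) S <-> beta_filter u [set n | beta_filter (s n) S]].

Lemma beta_sum_exists s : exists r, beta_sum s r.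
Proof.
have [r rc rs] := beta_extend s beta_omega_compact beta_omega_hausdorff.
have rS u S : beta_filter (r u) S -> beta_filter u [set n | beta_filter (s n) S].
  move=> rS; have Su : nbhs (r u) (beta_basic S) by apply/beta_nbhsP; exists S.
  have := beta_cvg rc Su.
  suff -> : [set n | beta_filter (s n) S] = (r \o beta_inj) @^-1` beta_basic S by [].
  by apply/funext => n; rewrite /= /beta_basic /= rs.
exists r; split => // u S; split; first exact: rS.
move=> uS; have [//|/rS nuS] := in_ultra_setVsetC S (beta_ultra (r u)).
have [n [/= sS snS]] := filter_ex (filterI uS nuS).
by have [k []] := filter_ex (filterI sS snS).
Qed.

Definition beta_embedding (r : beta_omega -> beta_omega) :=
  continuous r /\ injective r.

Lemma beta_embedding_comp r r' :
  beta_embedding r -> beta_embedding r' -> beta_embedding (r \o r').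
Proof.
move=> [rc ri] [r'c r'i]; split; last exact: inj_comp.
by move=> u; apply: continuous_comp; [exact: r'c|exact: rc].
Qed.

(** The disjoint [A n] recover [u] from [r u]: if [C] is in [u], the union of the [A n] over [C] is
    in [r u]. *)
Lemma beta_sum_embedding s r (A : nat -> set nat) : beta_sum s r ->
  (forall n, beta_filter (s n) (A n)) -> (forall m n k, A m k -> A n k -> m = n) ->
  beta_embedding r.
Proof.
move=> [rc rs rS] sA Adis; split => // u v ruv; apply: contrapT => /beta_neq[C uC vC].
pose W (C : set nat) := \bigcup_(n in C) A n.
have rW w D : beta_filter w D -> beta_filter (r w) (W D).
  move=> wD; apply/rS; apply: filterS wD => n Dn /=.
  by apply: filterS (sA n) => k Ak; exists n.
have [k [[m Cm Am] [n nCn An]]] : W C `&` W (~` C) !=set0.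
  apply: (@filter_ex _ (beta_filter (r u))); apply: filterI; first exact: rW.
  by rewrite ruv; exact: rW.
by apply: nCn; rewrite -(Adis _ _ _ Am An).
Qed.

Lemma beta_map_exists (b : nat -> nat) : injective b -> exists r,
  beta_embedding r /\ forall u S, beta_filter (r u) S <-> beta_filter u (b @^-1` S).
Proof.
move=> binj; have [r rsum] := beta_sum_exists (fun n => beta_inj (b n)).
exists r; split.
  apply: (beta_sum_embedding (A := fun n => [set b n]) rsum).
    by move=> n; apply/principal_filterP.
  by move=> m n k -> /binj.
have [_ _ rS] := rsum; move=> u S; rewrite rS.
have -> : [set n | beta_filter (beta_inj (b n)) S] = b @^-1` S; last by [].
by apply/predeqP => n; split => [/principal_filterP|Sb] //; apply/principal_filterP.
Qed.

Definition block (n j : nat) : nat := pickle (n, j).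

Lemma block_inj n : injective (block n).
Proof. by move=> j k /(pcan_inj pickleK)[]. Qed.

Lemma blocks_inj m n j k : block m j = block n k -> m = n /\ j = k.
Proof. by move=> /(pcan_inj pickleK)[-> ->]. Qed.

Lemma block_sum (iota : nat -> beta_omega -> beta_omega) (u : nat -> beta_omega)
    (A : nat -> set nat) :
  (forall n v S, beta_filter (iota n v) S <-> beta_filter v (block n @^-1` S)) ->
  (forall n, beta_filter (u n) (A n)) ->
  exists r, [/\ beta_embedding r, forall n, r (beta_inj n) = iota n (u n) &
   forall v C, beta_filter v C ->
     beta_filter (r v) [set k | exists n j, [/\ C n, A n j & k = block n j]]].
Proof.
move=> iotaP uA; have [r rsum] := beta_sum_exists (fun n => iota n (u n)).
have sA n : beta_filter (iota n (u n)) (block n @` A n).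
  by apply/iotaP; apply: filterS (uA n) => j Aj; exists j.
have [rc rs rS] := rsum.
exists r; split => //.
  apply: (beta_sum_embedding rsum sA).
  by move=> m n _ [j _ <-] [k _ /blocks_inj[]].
move=> v C vC; apply/rS; apply: filterS vC => n Cn.
by apply: filterS (sA n) => _ [j Aj <-]; exists n, j.
Qed.

Section Dichotomy.
Variables (K : topologicalType) (hK : hausdorff_space K).
Variables (pi_ : beta_omega -> K) (pic : continuous pi_).

(** The disjoint [A i] witness that the [k.+1] points differ, and later supply the members that
    [beta_sum_embedding] asks for. *)
Definition fiber_points (r : beta_omega -> beta_omega) (k : nat)
    (u : nat -> beta_omega) (A : nat -> set nat) :=
  [/\ forall i, (i <= k)%N -> beta_filter (u i) (A i),
      forall i j x, (i <= k)%N -> (j <= k)%N -> A i x -> A j x -> i = j &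
      forall i, (i <= k)%N -> pi_ (r (u i)) = pi_ (r (u 0))].

Let iota_exists : exists iota : nat -> beta_omega -> beta_omega,
  forall n, beta_embedding (iota n) /\
    forall v S, beta_filter (iota n v) S <-> beta_filter v (block n @^-1` S).
Proof.
by have /choice[iota iotaP] := fun n => beta_map_exists (@block_inj n); exists iota.
Qed.

Let comp_continuous r : beta_embedding r -> continuous (pi_ \o r).
Proof. by move=> [rc _] u; apply: continuous_comp; [exact: rc|exact: pic]. Qed.

Let pi_eq r r' : beta_embedding r -> beta_embedding r' ->
  (forall n, pi_ (r (beta_inj n)) = pi_ (r' (beta_inj n))) -> forall v, pi_ (r v) = pi_ (r' v).
Proof.
move=> er er' rr' v.
apply: (@beta_eq _ (pi_ \o r) (pi_ \o r') v hK (comp_continuous er) (comp_continuous er')).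
by apply: filterS (@filterT _ (beta_filter v) _) => n _ /=.
Qed.

(* A non-injective composite doubles one of the points of a fibre, after passing
   to limits of points taken in infinitely many disjoint copies of βω. *)
Lemma fiber_points_exist :
  (forall r, beta_embedding r -> ~ injective (pi_ \o r)) ->
  forall k r, beta_embedding r -> exists u A, fiber_points r k u A.
Proof.
move=> ninj; have [iota iotaP] := iota_exists.
elim=> [|k IHk] r er.
  exists (fun=> beta_inj 0), (fun=> setT); split => // i j x.
  by rewrite !leqn0 => /eqP -> /eqP ->.
have /choice[u /choice[A uA]] n : exists u A, fiber_points (r \o iota n) k u A.
  by apply: IHk; apply: beta_embedding_comp => //; have [] := iotaP n.
(* [s i] runs through the [i]-th fibre points of all copies. The composites of the [s i] with
   [pi_ \o r] agree on [nat], hence everywhere. *)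
have /choice[s sP] i : exists s, (i <= k)%N -> [/\ beta_embedding s,
    forall n, s (beta_inj n) = iota n (u n i) & forall v C, beta_filter v C ->
      beta_filter (s v) [set x | exists n j, [/\ C n, A n i j & x = block n j]]].
  have [ik|ki] := leqP i k; last by exists id.
  have [|n|s sP] := @block_sum iota (fun n => u n i) (fun n => A n i).
  - by move=> n; have [] := iotaP n.
  - by have [H _ _] := uA n; exact: H.
  - by exists s => _.
have [es0 s0 s0P] := sP 0 isT.
(* The additional point is [s 0 v']; it joins the points [s i v], and [C] separates it from them. *)
have [v [v' [vv' rvv']]] : exists v v', v <> v' /\ pi_ (r (s 0 v)) = pi_ (r (s 0 v')).
  apply: contrapT => nv; apply: (ninj (r \o s 0)); first exact: beta_embedding_comp.
  by move=> v v' e; apply: contrapT => vv'; apply: nv; exists v, v'.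
have [C vC v'C] := beta_neq vv'.
pose B i := [set x | exists n j, [/\ C n, A n i j & x = block n j]].
exists (fun i => if (i <= k)%N then s i v else s 0 v').
exists (fun i => if (i <= k)%N then B i
  else [set x | exists n j, [/\ (~` C) n, A n 0 j & x = block n j]]).
split.
- move=> i _; case: leqP => ik; last exact: s0P.
  by have [_ _] := sP i ik; exact.
- move=> i j x ik jk; case: leqP => ik'; case: leqP => jk'.
  + move=> [n [l [Cn Al ->]]] [n' [l' [_ Al' /blocks_inj[nn ll]]]]; subst n' l'.
    by have [_ H _] := uA n; exact: H Al Al'.
  + by move=> [n [l [Cn Al ->]]] [n' [l' [nC _ /blocks_inj[nn _]]]]; subst n'.
  + by move=> [n [l [nC Al ->]]] [n' [l' [Cn _ /blocks_inj[nn _]]]]; subst n'.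
  + by move=> _ _; apply/eqP; rewrite eqn_leq (leq_trans ik jk') (leq_trans jk ik').
- move=> i _; case: (leqP i k) => [ik|_] //=.
  have [es si _] := sP i ik.
  apply: (pi_eq (beta_embedding_comp er es) (beta_embedding_comp er es0)) => n /=.
  by rewrite si s0; have [_ _ H] := uA n; exact: H.
Qed.

(** Without an injective composite, the [n]-th copy has [n.+1] points in one fibre. The maps [t i]
    through the [i]-th of these points agree after [pi_], so for a free [v] all [t i v] lie in one
    fibre. They have disjoint members, hence span a copy of βω that [pi_] sends to a point. *)
Lemma beta_dichotomy :
  (exists2 r, beta_embedding r & injective (pi_ \o r)) \/
  (exists2 r, beta_embedding r & exists y, forall u, pi_ (r u) = y).
Proof.
have [|nr] := pselect (exists2 r, beta_embedding r & injective (pi_ \o r)); first by left.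
right; have [iota iotaP] := iota_exists.
have /fiber_points_exist D : forall r, beta_embedding r -> ~ injective (pi_ \o r).
  by move=> r er ri; apply: nr; exists r.
have /choice[u /choice[A uA]] n := D n _ (iotaP n).1.
(* [minn i n] is [i] except in the finitely many copies without an [i]-th point, which the free [v]
   ignores. *)
have /choice[t tP] i : exists t, [/\ beta_embedding t,
    forall n, t (beta_inj n) = iota n (u n (minn i n)) & forall v C, beta_filter v C ->
      beta_filter (t v) [set x | exists n j, [/\ C n, A n (minn i n) j & x = block n j]]].
  apply: (@block_sum iota (fun n => u n (minn i n)) (fun n => A n (minn i n))).
    by move=> n; have [] := iotaP n.
  by move=> n; have [H _ _] := uA n; apply: H; exact: geq_minr.
have [v0 [v0U _ v0np]] := nonprincipal_exists infinite_nat.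
pose v := BetaOmega v0U.
have [r rsum] := beta_sum_exists (fun i => t i v).
have er : beta_embedding r.
  apply: (beta_sum_embedding (A := fun i =>
    [set x | exists n j, [/\ (i <= n)%N, A n (minn i n) j & x = block n j]]) rsum).
    move=> i; have [_ _] := tP i; apply; apply: (ultra_cofinite v0U v0np).
    apply: (@sub_finite_set _ _ `I_i); last exact: finite_II.
    by move=> n /= /negP; rewrite -ltnNge.
  move=> i i' x [n [j [ni Aj ->]]] [n' [j' [ni' Aj' /blocks_inj[nn jj]]]]; subst n' j'.
  have [_ H _] := uA n; rewrite -(minn_idPl ni) -(minn_idPl ni').
  by apply: H Aj Aj'; exact: geq_minr.
exists r => //; exists (pi_ (t 0 v)) => w.
have [rc rs _] := rsum.
apply: (@beta_eq _ (pi_ \o r) (fun=> pi_ (t 0 v)) w hK (comp_continuous er)); first exact: cst_continuous.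
apply: filterS (@filterT _ (beta_filter w) _) => i _ /=; rewrite rs.
have [et ti _] := tP i; have [et0 t0 _] := tP 0.
apply: (pi_eq et et0) => n; rewrite ti t0 min0n.
by have [_ _ H] := uA n; apply: H; exact: geq_minr.
Qed.

End Dichotomy.

Lemma beta_inj_neq : beta_inj 0 <> beta_inj 1.
Proof.
move=> /(congr1 (fun u => beta_filter u [set 0])) e.
have : beta_filter (beta_inj 0) [set 0] by apply/principal_filterP.
by rewrite e => /principal_filterP.
Qed.

Lemma beta_finite_product (I : eqType) (X : I -> topologicalType) (L : seq I)
    (psi : forall a, beta_omega -> X a) :
  (forall a, hausdorff_space (X a)) -> (forall a, continuous (psi a)) ->
  (forall u v, (forall a, a \in L -> psi a u = psi a v) -> u = v) ->
  exists a r, [/\ a \in L, beta_embedding r & injective (psi a \o r)].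
Proof.
move=> hX; elim: L psi => [|a L IHL] psi psic psiinj.
  by exfalso; apply: beta_inj_neq; apply: psiinj.
have [[r er ri]|[r er [y ry]]] := beta_dichotomy (hX a) (psic a).
  by exists a, r; split => //; exact: mem_head.
have [||b [r' [bL er' ri']]] := IHL (fun a => psi a \o r).
- by move=> b u; apply: continuous_comp; [exact: er.1|exact: psic].
- move=> u v uv; apply: er.2; apply: psiinj => b; rewrite inE => /orP[/eqP ->|/uv//].
  by rewrite !ry.
exists b, (r \o r'); split => //; first by rewrite inE bL orbT.
exact: beta_embedding_comp.
Qed.


(** * Copies of βω in sequentially small sets *)

Lemma nbhs_set_type (X : topologicalType) (A : set X) (x : set_type A) (V : set X) :
  nbhs (set_val x) V -> nbhs x [set y : set_type A | V (set_val y)].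
Proof. by move=> xV; exact: (@initial_continuous A X set_val x V xV). Qed.

Lemma continuous_set_type (T X : topologicalType) (A : set X) (g : T -> set_type A) :
  continuous (set_val \o g) -> continuous g.
Proof.
move=> gc t V [W [[U oU <-] /= Uy] WV].
have : nbhs t [set t' | U (set_val (g t'))].
  by apply: (gc t U); exact: open_nbhs_nbhs.
by apply: filterS => t' /= /WV.
Qed.

Lemma contains_beta_omega_intro (X : topologicalType) (U : set X) (A : set (set_type U))
    (phi : beta_omega -> set_type U) :
  hausdorff_space X -> continuous (set_val \o phi) -> injective phi -> range phi `<=` A ->
  contains_beta_omega A.
Proof.
move=> hX pc pinj pA.
pose h u : range phi := SigSub (mem_set (ex_intro2 _ _ u I erefl) : phi u \in range phi).
have hval u : set_val (h u) = phi u by [].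
exists (range phi), h; split => //; split.
  apply: continuous_set_type; rewrite (_ : set_val \o h = phi); last exact/funext.
  exact: continuous_set_type.
have /choice[g gP] (y : range phi) : exists u, phi u = set_val y.
  by have [u _ uy] := set_valP y; exists u.
have hg : cancel g h by move=> y; apply: val_inj; exact: gP.
have gh : cancel h g by move=> u; apply: pinj; rewrite gP.
exists g; split => // y V gV.
(* For the continuity of the inverse: the complement of [V^°] is compact, so its image is closed,
   and it misses [y]. *)
pose C := (set_val \o phi) @` (~` V^°).
have cC : closed C.
  apply: compact_closed => //; apply: continuous_compact.
    by apply: continuous_subspaceT.
  apply: (subclosed_compact _ beta_omega_compact) => //.
  by rewrite closedC; exact: open_interior.
have yC : (~` C) (set_val (set_val y)).
  move=> [u nVu /= uy]; apply: nVu; suff -> : u = g y by exact: gV.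
  by apply: pinj; rewrite gP; apply: val_inj.
have nC : nbhs (set_val (set_val y)) (~` C).
  by apply: open_nbhs_nbhs; split => //; rewrite openC.
have := nbhs_set_type (nbhs_set_type nC); apply: filterS => y' /= y'C.
apply: contrapT => nV; apply: y'C; exists (g y'); last by rewrite /= gP.
by move=> /interior_subset.
Qed.

(** Every infinite part [B] of the image of [nat] contains the image of an injective sequence [b];
    the self-embedding of βω induced by [b] puts a copy of βω into the closure of [B]. *)
Lemma sequentially_small_beta (X : topologicalType) (U : set X) (phi : beta_omega -> X) :
  hausdorff_space X -> sequentially_small U -> continuous phi -> injective phi ->
  ~ (forall u, U (phi u)).
Proof.
move=> hX sU pc pinj Up.
pose f u : set_type U := SigSub (mem_set (Up u)).
have finj : injective f by move=> u v /(congr1 val) /pinj.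
have betai : injective beta_inj.
  move=> m n /(congr1 (fun u => beta_filter u [set m])) e.
  have : beta_filter (beta_inj m) [set m] by apply/principal_filterP.
  by rewrite e => /principal_filterP.
have fi : injective (f \o beta_inj) by exact: inj_comp.
have [B [BA infB nB]] := sU _ (infinite_range fi).
have infN : infinite_set [set n | B (f (beta_inj n))].
  move=> /(finite_image (f \o beta_inj)); apply: contra_not infB; apply: sub_finite_set.
  by move=> y By; have [n _ ny] := BA y By; exists n => //=; rewrite -[f _]/((f \o beta_inj) n) ny.
have [b binj bB] := infinite_seq infN.
have [r [[rc ri] rP]] := beta_map_exists binj.
have rb n : r (beta_inj n) = beta_inj (b n).
  apply: beta_ext; apply/funext => S; apply/propext; rewrite rP.
  by split => /principal_filterP h; apply/principal_filterP.
have prc : continuous (phi \o r).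
  by move=> u; apply: continuous_comp; [exact: rc|exact: pc].
apply: nB; apply: (@contains_beta_omega_intro _ _ _ (f \o r) hX).
- exact: prc.
- exact: inj_comp.
- move=> _ [u _ <-].
  have fr : ((f \o r) \o beta_inj) @ beta_filter u --> (f \o r) u.
    by apply: beta_cvg; apply: continuous_set_type; exact: prc.
  apply: closure_subset (cvg_closure fr filterT) => _ [n _ <-] /=.
  by rewrite rb; exact: bB.
Qed.

(** * Non-homogeneity of the product *)

Lemma choice_dep (I : Type) (T : I -> Type) (P : forall i, T i -> Prop) :
  (forall i, exists x, P i x) -> exists f : forall i, T i, forall i, P i (f i).
Proof. by move=> H; exists (fun i => sval (cid (H i))) => i; exact: svalP (cid (H i)). Qed.

Theorem theorem4 (kappa : Type) (X : kappa -> topologicalType)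
    (X_completely_regular : forall a, completely_regular_space (X a))
    (X_hausdorff : forall a, hausdorff_space (X a))
    (X_cond : forall a,
      [\/ infinite_compact_R2 (X a),
          exists x : X a, weak_P_point x |
          exists U : set (X a), [/\ open U, U !=set0 & sequentially_small U]])
    (X_R2 : exists a, infinite_compact_R2 (X a)) :
  ~ homogeneous (prod_topology X).
Proof.
move=> homX.
have [q [qU _ qnp]] := nonprincipal_exists infinite_nat.
have [p [pU p_image p_weak]] := exists_weak_P_ultrafilter (q := q) _.
pose qb := BetaOmega qU; pose pb := BetaOmega pU.
pose point_ok a (x : X a) := q_isolated q x \/
  exists U : set (X a), [/\ open U, U x & sequentially_small U].
have /choice_dep[x xok] a : exists x : X a, point_ok a x.
  have [[infX cX XR2]|[y wy]|[U [oU [y Uy] sU]]] := X_cond a.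
  - have [c [G cG]] := expanded_exists (X_hausdorff a) infX.
    have [g gc gE] := beta_extend c cX (X_hausdorff a).
    exists (g pb); left.
    apply: (expanded_limit_isolated qU pU p_image p_weak (X_hausdorff a) XR2 cG).
    have -> : c = g \o beta_inj by apply/funext => n; rewrite /= gE.
    exact: (beta_cvg (u := pb) gc).
  - by exists y; left; exact: weak_P_point_isolated.
  - by exists y; right; exists U.
have [a0 [infX cX XR2]] := X_R2.
have [c [G cG]] := expanded_exists (X_hausdorff a0) infX.
have [cl clc clE] := beta_extend c cX (X_hausdorff a0).
have cl_inj : injective cl.
  move=> u v uv; apply: contrapT => /beta_neq[C uC vC].
  suff : (@set0 (X a0)) (cl u) by [].
  have cE : c = cl \o beta_inj by apply/funext => n; rewrite /= clE.
  rewrite -(expanded_closure_disjoint XR2 cG (setICr C)) cE; split.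
    exact: (cvg_closure (beta_cvg clc) uC).
  by rewrite uv; exact: (cvg_closure (beta_cvg clc) vC).
pose e (u : beta_omega) : prod_topology X := @dfwith {classic kappa} X x a0 (cl u).
have e_a0 u : e u a0 = cl u by rewrite /e; exact: dfwithin.
have ec : continuous e.
  move=> u; have FF : Filter (e @ u) := fmap_filter e (nbhs_filter u).
  apply/prod_cvgP => a V.
  have [aa0|aa0] := pselect (a = a0).
    subst a; rewrite e_a0 => /clc uV.
    suff -> : (e @ u) [set w | V (w a0)] = nbhs u (cl @^-1` V) by [].
    rewrite /fmap /= /fmap /=; congr (nbhs u _).
    by apply/funext => v; rewrite /= e_a0.
  have eE v : e v a = x a by rewrite /e dfwithout //; apply/eqP => /esym.
  rewrite eE => /nbhs_singleton Vx.
  suff : nbhs u [set v | V (e v a)] by [].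
  by apply: filterS (@filterT _ (nbhs u) _) => v _ /=; rewrite eE.
have [h [[hc [g [gc hK gK]]] hx]] := homX (e qb) (x : prod_topology X).
pose Z u := h (e u).
have Zc : continuous Z by move=> u; apply: continuous_comp; [exact: ec|exact: hc].
pose f (w : prod_topology X) := g w a0.
have fc : continuous f.
  move=> w; apply: (@continuous_comp _ _ _ g (fun w : prod_topology X => w a0)).
    exact: gc.
  exact: (@prod_proj_continuous _ X a0).
have fZ u : f (Z u) = cl u by rewrite /f /Z hK e_a0.
have [||F [N [finF FN]]] := finitely_determined (z := Z \o beta_inj) (X_hausdorff a0) XR2 cG fc.
- by move=> n; rewrite /= fZ clE.
- by move=> u uU; exists (Z (BetaOmega uU)); exact: (beta_cvg (u := BetaOmega uU) Zc).
have Za a : continuous (fun u => Z u a).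
  move=> u; apply: (@continuous_comp _ _ _ Z (fun w : prod_topology X => w a)).
    exact: Zc.
  exact: (@prod_proj_continuous _ X a).
(* [w n] has its coordinates in [F] from [Z (beta_inj n)] and the others from [Z v]. Along [u] it
   tends to [Z v], while [f (w n) = c n] from [N] on, so [cl u = cl v]; freeness of [u] discards the
   indices below [N]. *)
have Z_inj u v : (forall k, ~ beta_filter u [set k]) ->
    (forall a, F a -> Z u a = Z v a) -> u = v.
  move=> unp uv; apply: cl_inj.
  pose w n : prod_topology X := fun a => if pselect (F a) then Z (beta_inj n) a else Z v a.
  have wv : w @ beta_filter u --> Z v.
    apply/prod_cvgP => a V ZV.
    suff : beta_filter u [set n | V (w n a)] by [].
    rewrite /w; case: (pselect (F a)) => [Fa|nFa]; last first.
      apply: filterS (@filterT _ (beta_filter u) _) => n _ /=.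
      exact: nbhs_singleton.
    by apply: (beta_cvg (u := u) (Za a)); rewrite uv.
  have fw : f \o w @ beta_filter u --> cl v.
    by rewrite -fZ; apply: cvg_comp wv _; exact: fc.
  apply: (cvg_unique (X_hausdorff a0) (beta_cvg (u := u) clc)).
  move=> V clV; have wV : beta_filter u [set n | V (f (w n))] by exact: fw.
  suff : beta_filter u [set n | V (cl (beta_inj n))] by [].
  have uN : beta_filter u [set n | (N <= n)%N].
    apply: (ultra_cofinite (beta_ultra u) unp).
    apply: (@sub_finite_set _ _ `I_N); last exact: finite_II.
    by move=> n /= /negP; rewrite -ltnNge.
  apply: filterS (filterI wV uN) => n [/= + Nn]; rewrite /= clE.
  rewrite (FN n (w n) Nn) // => a Fa; rewrite /w.
  by case: pselect.
(* At a [q_isolated] coordinate, [Z] takes the value [x a] at [q]-many integers, hence on the whole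
   closure of these. *)
have /choice[A AP] a : exists A : set nat, q A /\
    ((forall u, beta_filter u A -> Z u a = x a) \/
     exists2 U : set (X a), sequentially_small U & forall u, beta_filter u A -> U (Z u a)).
  have Zx : Z qb a = x a by rewrite /Z hx.
  have [iso|[U [oU Ux sU]]] := xok a.
    exists [set n | Z (beta_inj n) a = x a]; split.
      by apply: iso; rewrite -Zx; exact: (beta_cvg (u := qb) (Za a)).
    left => u uA.
    apply: (@beta_eq _ (fun u => Z u a) (fun=> x a) u (X_hausdorff a) (Za a)) => //.
    exact: cst_continuous.
  have /Za /beta_nbhsP[A qA AU] : nbhs (Z qb a) U.
    by rewrite Zx; exact: open_nbhs_nbhs.
  by exists A; split => //; right; exists U => // u /AU.
have [s sF] := (@finite_seqP {classic kappa} F).1 finF.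
have qB : q [set n | forall a, F a -> A a n].
  rewrite sF; elim: s {sF} => [|a s IHs].
    by apply: filterS filterT => n _ a.
  apply: filterS (filterI (AP a).1 IHs) => n [An sn] b /=.
  by rewrite inE => /orP[/eqP ->|/sn].
set B := [set n | _] in qB.
have infB : infinite_set B by move=> /(ultra_finite qU qnp).
have [b binj bB] := infinite_seq infB.
(* Copies of [q] on disjoint parts of [B] generate a copy of βω made of free ultrafilters containing
   [B], so that [Z_inj] and [AP] apply to all its points. *)
have /choice[t tP] n : exists t : beta_omega, forall S,
    beta_filter t S <-> q ((b \o block n) @^-1` S).
  have [|r [_ rP]] := @beta_map_exists (b \o block n).
    by apply: inj_comp => //; exact: block_inj.
  by exists (r qb) => S; rewrite rP.
have [r rsum] := beta_sum_exists t.
have er : beta_embedding r.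
  apply: (beta_sum_embedding (A := fun n => range (b \o block n)) rsum).
    by move=> n; apply/tP; apply: filterS filterT => j _; exists j.
  by move=> m n _ [j _ <-] [k _ /binj/blocks_inj[]].
have [rc rE rS] := rsum.
have rB u : beta_filter (r u) B.
  apply/rS; apply: filterS (@filterT _ (beta_filter u) _) => n _ /=.
  by apply/tP; apply: filterS filterT => j _ /=; exact: bB.
have rnp u k : ~ beta_filter (r u) [set k].
  move=> /rS /filter_ex[n /= /tP]; apply: (ultra_finite qU qnp).
  apply: finite_preimage; last exact: finite_set1.
  by move=> i j _ _ /binj/block_inj.
have Zrc a : continuous (fun u => Z (r u) a).
  by move=> u; exact: (@continuous_comp _ _ _ r (fun v => Z v a) u (rc u) (Za a (r u))).
have [||a [r' [aF er' ri]]] :=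
  @beta_finite_product {classic kappa} X s (fun a u => Z (r u) a) X_hausdorff.
- exact: Zrc.
- move=> u v uv; apply: er.2; apply: Z_inj => // a; rewrite sF => /= sa.
  exact: uv.
have Fa : F a by rewrite sF.
have rA u : beta_filter (r u) (A a).
  by apply: filterS (rB u) => n; exact.
have [_ [cst|[U sU UZ]]] := AP a.
  by apply: beta_inj_neq; apply: ri; rewrite /= !cst.
apply: (sequentially_small_beta (X_hausdorff a) sU _ ri).
  by move=> u; apply: continuous_comp; [exact: er'.1|exact: Zrc].
by move=> u; apply: UZ; exact: rA.
Qed.
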